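(* Let $0<r_1<r_2$, let $\Omega=\{r_1<r<r_2\}\subset\mathbb{R}^2$ (polar coordinates $(r,\theta)$), let $g,q,b,z_d\in\mathbb{R}$, $\alpha>0$, and let $u,p,u_\alpha,p_\alpha$ be the states and adjoint states defined in the context. Then: i) \begin{align*} u(r,\theta)&= g\tfrac{r_1^2}{2}\left(\left(\tfrac{r_2}{r_1} \right)^2\log\left(\tfrac{r}{r_1} \right)-\tfrac{1}{2} \left(\tfrac{r}{r_1} \right)^2+\tfrac{1}{2} \right)-q r_2 \log\left( \tfrac{r}{r_1}\right)+b,\\ p(r,\theta)&= g \tfrac{r_1^2 r^2}{8} \left(\tfrac{1}{8}\left( \tfrac{r}{r_1}\right)^2-\tfrac{1}{2}-\left(\tfrac{r_2}{r_1} \right)^2 \left( \log\left(\tfrac{r}{r_1} \right)-1\right) \right)+q \tfrac{r_2 r^2}{4} \left( \log\left(\tfrac{r}{r_1} \right)-1 \right)-(b-z_d)\tfrac{r^2}{4}+D_1 \log\left(\tfrac{r}{r_1}\right)+D_2, \end{align*} where \begin{align*} D_1 &= \tfrac{r_2^2}{2}\left[g\tfrac{r_1^2}{2}\left( \left(\tfrac{r_2}{r_1} \right)^2 \left(\log\left( \tfrac{r_2}{r_1}\right)-\tfrac{3}{4} \right)+\tfrac{1}{2} \right)-q r_2 \left(\log\left(\tfrac{r_2}{r_1} \right)-\tfrac{1}{2} \right) +(b-z_d) \right],\\ D_2&=\tfrac{r_1^2}{4} \left[g \tfrac{r_1^2}{2}\left(\tfrac{3}{8}-\left(\tfrac{r_2}{r_1}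 \right)^2 \right) +qr_2+ (b-z_d)\right]. \end{align*} ii) \begin{align*} u_{\alpha }(r,\theta)&=g\tfrac{r_1^2}{2} \left[ \left( \tfrac{r_2}{r_1}\right)^2\left( \log\left(\tfrac{r}{r_1} \right) +\tfrac{1}{\alpha r_1} \right) - \tfrac{1}{2}\left( \tfrac{r}{r_1}\right)^2+\tfrac{1}{2}-\tfrac{1}{\alpha r_1} \right] -qr_{2}\left(\log\left(\tfrac{r}{r_1}\right)+\tfrac{1}{\alpha r_{1}}\right)+b,\\ p_{\alpha }(r,\theta)&=g \tfrac{r_1^2 r^2}{8} \left[\tfrac{1}{8}\left(\tfrac{r}{r_1} \right)^2 -\tfrac{1}{2}-\left( \tfrac{r_2}{r_1}\right)^2 \left(\log\left( \tfrac{r}{r_1}\right)-1-\tfrac{r_1}{\alpha r_2^2} +\tfrac{1}{\alpha r_1}\right)\right]\\ &\quad +q \tfrac{r_2 r^2}{4} \left(\log\left(\tfrac{r}{r_1}\right)-1+\tfrac{1}{\alpha r_1} \right) -(b-z_d)\tfrac{r^2}{4}+D_{1\alpha } \log\left( \tfrac{r}{r_1}\right)+D_{2\alpha}, \end{align*} where \begin{align*} D_{1\alpha} &= \tfrac{r_2^2}{2} \left[ g\tfrac{r_1^2}{2}\left( \left(\tfrac{r_2}{r_1} \right)^2 \left(\log\left( \tfrac{r_2}{r_1}\right)-\tfrac{3}{4}+\tfrac{1}{\alpha r_1} \right)+\tfrac{1}{2}-\tfrac{1}{\alpha r_1} \right)-q r_2 \left(\log\left(\tfrac{r_2}{r_1}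 \right)-\tfrac{1}{2}+\tfrac{1}{\alpha r_1} \right)+(b-z_d) \right], \\ D_{2\alpha} &= \tfrac{r_1^2}{4}\left[ g\tfrac{r_1^2}{2}\left( \tfrac{3}{8}-\left(\tfrac{r_2}{r_1} \right)^2 \left( 1+\tfrac{r_1}{\alpha r_2^2}-\tfrac{2}{\alpha r_1}+\tfrac{2}{\alpha^2 r_1^2}\right)+\tfrac{2}{\alpha^2 r_1^2}-\tfrac{1}{2\alpha r_1} \right)\right.\\ &\quad\left.+ qr_2\left(1-\tfrac{2}{\alpha r_1 }+\tfrac{2}{\alpha^2 r_1^2} \right)+ (b-z_d)\left(1-\tfrac{2}{\alpha r_1} \right)\right] +\tfrac{D_{1\alpha}}{\alpha r_1}. \end{align*}
   Context: $\Gamma_1=\{r=r_1\}$, $\Gamma_2=\{r=r_2\}$; $\partial/\partial n$ is the outward normal derivative. The following are the unique (variational, $H^1(\Omega)$) solutions of the respective mixed problems: $u$: $-\Delta u=g$ in $\Omega$, $u|_{\Gamma_1}=b$, $-\frac{\partial u}{\partial n}|_{\Gamma_2}=q$; $p$ (adjoint state): $-\Delta p=u-z_d$ in $\Omega$, $p|_{\Gamma_1}=0$, $\frac{\partial p}{\partial n}|_{\Gamma_2}=0$; $u_\alpha$: $-\Delta u_\alpha=g$ in $\Omega$, $-\frac{\partial u_\alpha}{\partial n}|_{\Gamma_1}=\alpha(u_\alpha-b)$, $-\frac{\partial u_\alpha}{\partial n}|_{\Gamma_2}=q$; $p_\alpha$ (adjoint state): $-\Delta p_\alpha=u_\alpha-z_d$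 in $\Omega$, $-\frac{\partial p_\alpha}{\partial n}|_{\Gamma_1}=\alpha p_\alpha$, $\frac{\partial p_\alpha}{\partial n}|_{\Gamma_2}=0$. *)

(* Defs.v *)
(* The plane is R * R, with the product of Lebesgue measures. *)
From HB Require Import structures.
From mathcomp Require Import all_boot all_order all_algebra.
From mathcomp Require Import all_classical all_reals all_analysis.
Set Implicit Arguments.
Unset Strict Implicit.
Unset Printing Implicit Defensive.
Import Order.TTheory GRing.Theory Num.Theory.
Import numFieldNormedType.Exports.
Local Open Scope classical_set_scope.
Local Open Scope ring_scope.

Notation leb R := (@lebesgue_measure R).
Notation leb2 R := (@lebesgue_measure R \x @lebesgue_measure R)%E.

Section Geometry.
Context {R : realType}.
Implicit Types (x : R * R) (rho theta : R) (f : R * R -> R).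

Definition polar_r x : R := Num.sqrt (x.1 ^+ 2 + x.2 ^+ 2).

Definition annulus (r1 r2 : R) : set (R * R) := [set x | r1 < polar_r x < r2].

Definition circle rho theta : R * R := (rho * cos theta, rho * sin theta).

Definition angles : set R := `[0, 2 * pi].

(* Integral over {r = rho} with respect to arc length rho dtheta. *)
Definition circle_int rho f : R :=
  rho * (\int[leb R]_(theta in angles) f (circle rho theta)).

End Geometry.

Section L2.
Context d {T : measurableType d} {R : realType}.
Variables (mu : {measure set T -> \bar R}) (D : set T).

Definition L2 (f : T -> R) : Prop := f \_ D \in Lfun mu 2%:E.

Definition L2_cvg (fs : nat -> T -> R) (f : T -> R) : Prop :=
  (fun n => Lnorm mu 2%:E (EFin \o (fs n \- f) \_ D)) @ \oo --> 0%E.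

End L2.

Section Regularity.
Context {R : realType}.
Implicit Types (f phi : R * R -> R) (U D : set (R * R)).

Definition dx f : R * R -> R := 'D_((1, 0) : R * R) f.
Definition dy f : R * R -> R := 'D_((0, 1) : R * R) f.

(* f is of class C^k on the open set U. *)
Fixpoint Ck U (k : nat) f : Prop :=
  (forall x, U x -> {for x, continuous f}) /\
  match k with
  | 0 => True
  | j.+1 =>
      [/\ forall x, U x -> derivable f x (1, 0) /\ derivable f x (0, 1),
          Ck U j (dx f) & Ck U j (dy f)]
  end.

(* C^1(closure D): f is C^1 on a neighbourhood of closure D. *)
Definition C1_closure D f : Prop :=
  exists U, [/\ open U, closure D `<=` U & Ck U 1 f].

Definition test_function D phi : Prop :=
  [/\ forall k, Ck setT k phi,
      compact (closure [set x | phi x != 0]) &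
      closure [set x | phi x != 0] `<=` D].

End Regularity.

Section Sobolev.
Context {R : realType}.
Variables (r1 r2 : R).
Implicit Types (u v t : R * R -> R) (Gu Gv : R * R -> R * R).

Local Notation Omega := (annulus r1 r2).

(* u \in H^1(Omega), with weak gradient Gu. *)
Definition H1 u Gu : Prop :=
  [/\ L2 (leb2 R) Omega u, L2 (leb2 R) Omega (fst \o Gu),
      L2 (leb2 R) Omega (snd \o Gu) &
      forall phi, test_function Omega phi ->
        (\int[leb2 R]_(x in Omega) (u x * dx phi x)) =
          - (\int[leb2 R]_(x in Omega) ((Gu x).1 * phi x)) /\
        (\int[leb2 R]_(x in Omega) (u x * dy phi x)) =
          - (\int[leb2 R]_(x in Omega) ((Gu x).2 * phi x))].

(* t is the trace in L^2(bd Omega) of the function u \in H^1(Omega) with weak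
   gradient Gu: the trace operator is the continuous extension to H^1(Omega) of
   the restriction C^1(closure Omega) -> L^2(bd Omega), C^1(closure Omega) being
   dense in H^1(Omega). Only the values of t on the circles {r = r1} and
   {r = r2} matter. *)
Definition is_trace u Gu t : Prop :=
  [/\ L2 (leb R) angles (t \o circle r1),
      L2 (leb R) angles (t \o circle r2) &
      exists phi : nat -> R * R -> R,
        [/\ forall n, C1_closure Omega (phi n),
            L2_cvg (leb2 R) Omega phi u,
            L2_cvg (leb2 R) Omega (dx \o phi) (fst \o Gu) /\
            L2_cvg (leb2 R) Omega (dy \o phi) (snd \o Gu),
            L2_cvg (leb R) angles (fun n => phi n \o circle r1)
                                  (t \o circle r1) &
            L2_cvg (leb R) angles (fun n => phi n \o circle r2)
                                  (t \o circle r2)]].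

(* The value on {r = rho} of the boundary function t is the constant c. *)
Definition trace_eq rho t (c : R) : Prop :=
  ae_eq (leb R) angles (t \o circle rho) (cst c).

Definition dirichlet_form Gu Gv : R :=
  \int[leb2 R]_(x in Omega) ((Gu x).1 * (Gv x).1 + (Gu x).2 * (Gv x).2).

(* u is a variational solution of
     - Delta u = f in Omega,  u = c on {r = r1},  - du/dn = h on {r = r2}. *)
Definition dirichlet_solution (f : R * R -> R) (c h : R) u : Prop :=
  exists Gu tu,
    [/\ H1 u Gu, is_trace u Gu tu, trace_eq r1 tu c &
        forall v Gv tv, H1 v Gv -> is_trace v Gv tv -> trace_eq r1 tv 0 ->
          dirichlet_form Gu Gv =
          (\int[leb2 R]_(x in Omega) (f x * v x)) - h * circle_int r2 tv].

(* u is a variational solution of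
     - Delta u = f in Omega,  - du/dn = a (u - c) on {r = r1},
     - du/dn = h on {r = r2}. *)
Definition robin_solution (a : R) (f : R * R -> R) (c h : R) u : Prop :=
  exists Gu tu,
    [/\ H1 u Gu, is_trace u Gu tu &
        forall v Gv tv, H1 v Gv -> is_trace v Gv tv ->
          dirichlet_form Gu Gv + a * circle_int r1 (fun x => tu x * tv x) =
          (\int[leb2 R]_(x in Omega) (f x * v x))
          + a * c * circle_int r1 tv - h * circle_int r2 tv].

End Sobolev.

Section Formulas.
Context {R : realType}.
Variables (r1 r2 g q b zd alpha : R).
Implicit Type r : R.

Definition u_expr r : R :=
  g * (r1 ^+ 2 / 2)
    * ((r2 / r1) ^+ 2 * ln (r / r1) - 1 / 2 * (r / r1) ^+ 2 + 1 / 2)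
  - q * r2 * ln (r / r1) + b.

Definition D1 : R :=
  r2 ^+ 2 / 2
  * (g * (r1 ^+ 2 / 2) * ((r2 / r1) ^+ 2 * (ln (r2 / r1) - 3 / 4) + 1 / 2)
     - q * r2 * (ln (r2 / r1) - 1 / 2) + (b - zd)).

Definition D2 : R :=
  r1 ^+ 2 / 4
  * (g * (r1 ^+ 2 / 2) * (3 / 8 - (r2 / r1) ^+ 2) + q * r2 + (b - zd)).

Definition p_expr r : R :=
  g * (r1 ^+ 2 * r ^+ 2 / 8)
    * (1 / 8 * (r / r1) ^+ 2 - 1 / 2 - (r2 / r1) ^+ 2 * (ln (r / r1) - 1))
  + q * (r2 * r ^+ 2 / 4) * (ln (r / r1) - 1)
  - (b - zd) * (r ^+ 2 / 4) + D1 * ln (r / r1) + D2.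

Definition ua_expr r : R :=
  g * (r1 ^+ 2 / 2)
    * ((r2 / r1) ^+ 2 * (ln (r / r1) + 1 / (alpha * r1))
       - 1 / 2 * (r / r1) ^+ 2 + 1 / 2 - 1 / (alpha * r1))
  - q * r2 * (ln (r / r1) + 1 / (alpha * r1)) + b.

Definition D1a : R :=
  r2 ^+ 2 / 2
  * (g * (r1 ^+ 2 / 2)
       * ((r2 / r1) ^+ 2 * (ln (r2 / r1) - 3 / 4 + 1 / (alpha * r1))
          + 1 / 2 - 1 / (alpha * r1))
     - q * r2 * (ln (r2 / r1) - 1 / 2 + 1 / (alpha * r1)) + (b - zd)).

Definition D2a : R :=
  r1 ^+ 2 / 4
  * (g * (r1 ^+ 2 / 2)
       * (3 / 8
          - (r2 / r1) ^+ 2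
            * (1 + r1 / (alpha * r2 ^+ 2) - 2 / (alpha * r1)
               + 2 / (alpha ^+ 2 * r1 ^+ 2))
          + 2 / (alpha ^+ 2 * r1 ^+ 2) - 1 / (2 * alpha * r1))
     + q * r2 * (1 - 2 / (alpha * r1) + 2 / (alpha ^+ 2 * r1 ^+ 2))
     + (b - zd) * (1 - 2 / (alpha * r1)))
  + D1a / (alpha * r1).

Definition pa_expr r : R :=
  g * (r1 ^+ 2 * r ^+ 2 / 8)
    * (1 / 8 * (r / r1) ^+ 2 - 1 / 2
       - (r2 / r1) ^+ 2
         * (ln (r / r1) - 1 - r1 / (alpha * r2 ^+ 2) + 1 / (alpha * r1)))
  + q * (r2 * r ^+ 2 / 4) * (ln (r / r1) - 1 + 1 / (alpha * r1))
  - (b - zd) * (r ^+ 2 / 4) + D1a * ln (r / r1) + D2a.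

End Formulas.

(* Main.v *)
Require Import Defs.
From HB Require Import structures.
From mathcomp Require Import all_boot all_order all_algebra.
From mathcomp Require Import all_classical all_reals all_analysis.
From mathcomp Require Import measurable_realfun ring lra.
Set Implicit Arguments.
Unset Strict Implicit.
Unset Printing Implicit Defensive.
Import Order.TTheory GRing.Theory Num.Theory.
Import numFieldNormedType.Exports.
Local Open Scope classical_set_scope.
Local Open Scope ring_scope.

(** The four functions are radial. For [U = h (x^2 + y^2)] the Laplacian and
    the normal derivatives on the two circles are explicit in [h'] and
    [h''], so that the displayed formulas solve the four boundary value
    problems in the classical sense is algebra ([dirichlet_system],
    [robin_system]). The analysis consists in showing that such classical
    solutions are variational solutions, and that variational solutions are
    unique up to null sets.

    Both rest on the divergence theorem on the annulus ([integral_dx],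
    [integral_dy]), which is obtained in Cartesian coordinates. By Fubini's
    theorem, one integrates a partial derivative along each line parallel to
    an axis; the fundamental theorem of calculus leaves the values at the
    ends of the chords cut by the two circles; and the substitution
    [y = r sin t], or [x = r cos t], turns the integral over the chords of
    one circle into the flux through that circle.

    Applied to the field [v grad U], this is Green's formula for a radial
    [U] and a [v] that is smooth up to the boundary ([radial_green]). Both
    sides are continuous along the smooth functions that define the trace of
    an H^1 function, so the formula holds for all [v] in H^1
    ([radial_green_trace]): this is the weak formulation, and gives
    existence.

    For uniqueness, the difference [w] of two solutions, used as a test
    function, has zero Dirichlet energy and zero trace on the inner circle.
    Poincare's inequality ([poincare]) is again a case of Green's formula,
    for the [U] with [- Delta U = 1] and [dU/dn = 0] on the outer circle,
    and [v = phi^2]; it passes to the limit and gives [w = 0]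
    ([vanishing_H1]). Finally, the state enters the adjoint equation only
    through its class modulo null sets, so uniqueness of the state implies
    that of the adjoint state. *)

(** * Square-integrable functions *)

Section L2_theory.
Context d {T : measurableType d} {R : realType}.
Variables (mu : {measure set T -> \bar R}) (D : set T).
Hypothesis mD : measurable D.
Implicit Types f g h : T -> R.

Local Notation int f := (\int[mu]_(x in D) f x).
Local Notation integrable f := (mu.-integrable D (EFin \o f)).

Lemma L2P f : L2 mu D f <->
  measurable_fun D f /\ integrable (fun x => f x ^+ 2).
Proof.
have resE : (fun x => (f \_ D) x ^+ 2) = (fun x => f x ^+ 2) \_ D.
  by apply/funext => x; rewrite !patchE; case: ifP => // _; rewrite expr0n.
split.
- move=> f2; split.
    apply/(measurable_restrictT f mD).
    by move: f2; rewrite /L2 inE => /andP[]; rewrite inE.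
  have := Lfun2_integrable_sqr f2.
  by rewrite resE -restrict_EFin => /(integrable_mkcond _ mD).
- move=> [mf f2]; rewrite /L2 inE; apply/andP; split; rewrite inE /=.
    exact/(measurable_restrictT f mD).
  rewrite /finite_norm unlock; apply: poweR_lty.
  move: f2 => /(integrable_mkcond _ mD); rewrite restrict_EFin -resE.
  move=> /integrableP[_]; apply: le_lt_trans.
  rewrite le_eqVlt; apply/orP; left; apply/eqP.
  apply: eq_integral => x _ /=.
  by rewrite powR_mulrn // normrX.
Qed.

Lemma L2_measurable f : L2 mu D f -> measurable_fun D f.
Proof. by case/L2P. Qed.

Lemma L2_sqr_integrable f : L2 mu D f -> integrable (fun x => f x ^+ 2).
Proof. by case/L2P. Qed.

Lemma L2M_integrable f g : L2 mu D f -> L2 mu D g ->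
  integrable (fun x => f x * g x).
Proof.
move=> f2 g2; have := Lfun2_mul_Lfun1 f2 g2.
move/(Lfun1_integrable mu).
rewrite (_ : _ \* _ = (fun x => f x * g x) \_ D); last first.
  by apply/funext => x /=; rewrite !patchE; case: ifP => // _; rewrite mulr0.
by rewrite -restrict_EFin => /(integrable_mkcond _ mD).
Qed.

Lemma L2Z a f : L2 mu D f -> L2 mu D (fun x => a * f x).
Proof.
move=> f2; apply/L2P; split.
  by apply: measurable_funM => //; exact: L2_measurable.
have := integrableZl mD (a ^+ 2) (L2_sqr_integrable f2).
apply: eq_integrable => // x _ /=.
by rewrite -EFinM exprMn.
Qed.

Lemma L2D f g : L2 mu D f -> L2 mu D g -> L2 mu D (fun x => f x + g x).
Proof.
move=> f2 g2; apply/L2P; split.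
  by apply: measurable_funD; exact: L2_measurable.
have := integrableD mD (integrableD mD (L2_sqr_integrable f2)
  (L2_sqr_integrable g2)) (integrableZl mD 2 (L2M_integrable f2 g2)).
apply: eq_integrable => // x _ /=.
by rewrite -EFinM -!EFinD; congr EFin; ring.
Qed.

Lemma L2B f g : L2 mu D f -> L2 mu D g -> L2 mu D (fun x => f x - g x).
Proof.
move=> f2 g2; have := L2D f2 (L2Z (-1) g2).
by under [X in L2 _ _ X -> _]eq_fun => x do rewrite mulN1r.
Qed.

Lemma bounded_L2 f M : (mu D < +oo)%E -> measurable_fun D f ->
  (forall x, D x -> `|f x| <= M) -> L2 mu D f.
Proof.
move=> muD mf fM; apply/L2P; split=> //.
apply: measurable_bounded_integrable => //; first exact: measurable_funX.
exists (M ^+ 2); split; first exact: num_real.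
move=> y My x Dx /=; apply: le_trans (ltW My).
by rewrite normrX ler_sqr ?nnegrE ?fM // (le_trans _ (fM _ Dx)).
Qed.

Lemma L2_cst (c : R) : (mu D < +oo)%E -> L2 mu D (cst c).
Proof. by move=> muD; apply: (@bounded_L2 _ `|c|). Qed.

Lemma L2_integrable f : (mu D < +oo)%E -> L2 mu D f -> integrable f.
Proof.
move=> muD f2; have := L2M_integrable (L2_cst 1 muD) f2.
by apply: eq_integrable => // x _ /=; rewrite mul1r.
Qed.

(** Positivity of the quadratic form [t |-> \int (t f + g)^2]. *)
Lemma cauchy_schwarz f g : L2 mu D f -> L2 mu D g ->
  (int (fun x => f x * g x)) ^+ 2 <=
  int (fun x => f x ^+ 2) * int (fun x => g x ^+ 2).
Proof.
move=> f2 g2.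
set a := int (fun x => f x ^+ 2); set c := int (fun x => g x ^+ 2).
set b := int _.
have a0 : 0 <= a by apply: Rintegral_ge0 => x _; exact: sqr_ge0.
have c0 : 0 <= c by apply: Rintegral_ge0 => x _; exact: sqr_ge0.
have quad t : 0 <= t ^+ 2 * a + 2 * t * b + c.
  have := Rintegral_ge0 mu (f := fun x => (t * f x + g x) ^+ 2) (D := D).
  move=> /(_ (fun _ _ => sqr_ge0 _)).
  rewrite (_ : Rintegral _ _ _ = t ^+ 2 * a + 2 * t * b + c) // /a /b /c.
  have i1 := L2_sqr_integrable f2; have i2 := L2M_integrable f2 g2.
  have i3 := L2_sqr_integrable g2.
  rewrite -(RintegralZl _ mD i1) -(RintegralZl _ mD i2) -RintegralD //;
    last 2 first.
  - exact: (integrableZl mD (t ^+ 2) i1).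
  - exact: (integrableZl mD (2 * t) i2).
  rewrite -RintegralD //; last first.
    exact: (integrableD mD (integrableZl mD (t ^+ 2) i1)
      (integrableZl mD (2 * t) i2)).
  by apply: eq_Rintegral => x _; ring.
have [a00|an0] := eqVneq a 0.
  have [->|bn0] := eqVneq b 0; first by rewrite expr0n mulr_ge0.
  have := quad (- (c + 1) / (2 * b)).
  rewrite a00 mulr0 add0r (_ : 2 * _ * b = - (c + 1)); last by field.
  by lra.
have ap : 0 < a by rewrite lt_neqAle eq_sym an0.
have := quad (- b / a).
rewrite (_ : _ + _ = (a * c - b ^+ 2) / a); last by field.
by rewrite pmulr_lge0 ?invr_gt0 // subr_ge0.
Qed.

(** Convergence in L2 is stated with extended-real norms; the square of such a
    norm is the integral of the square, whose limit is taken in [R]. *)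
Lemma L2_cvg_sqr (fs : nat -> T -> R) f : (forall n, L2 mu D (fs n)) ->
  L2 mu D f -> L2_cvg mu D fs f ->
  (fun n => int (fun x => (fs n x - f x) ^+ 2)) @ \oo --> 0.
Proof.
move=> fs2 f2 /fine_cvgP[_ cvN].
rewrite (_ : (fun n => _) = (fun n => fine (Lnorm mu 2%:E
    (EFin \o (fs n \- f) \_ D)) * fine (Lnorm mu 2%:E
    (EFin \o (fs n \- f) \_ D)))); last first.
  apply/funext => n.
  have hn2 := L2B (fs2 n) f2.
  have fin : Lnorm mu 2%:E (EFin \o (fs n \- f) \_ D) \is a fin_num.
    rewrite ge0_fin_numE ?Lnorm_ge0 //.
    by move: hn2; rewrite /L2 inE => /andP[_]; rewrite inE.
  apply: EFin_inj; rewrite EFinM (fineK fin) /Rintegral fineK; last first.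
    by apply: integrable_fin_num => //; exact: L2_sqr_integrable.
  have -> : forall N : \bar R, (N \is a fin_num -> 0 <= N ->
      N * N = N `^ 2)%E.
    by case=> // r _; rewrite lee_fin => r0 /=; rewrite powR_mulrn // expr2.
  - rewrite poweR_Lnorm // integral_mkcond; apply: eq_integral => x _ /=.
    rewrite !patchE; case: ifP => _ /=.
      by rewrite powR_mulrn // -normrX ger0_norm // sqr_ge0.
    by rewrite normr0 powR0.
  - exact: fin.
  - exact: Lnorm_ge0.
rewrite -(mulr0 (0 : R)).
exact: cvgM.
Qed.

(** Integration against an L2 function is continuous in L2, by
    Cauchy-Schwarz: this is how identities pass to the limit below. *)
Lemma L2_cvg_integral (fs : nat -> T -> R) f g : (forall n, L2 mu D (fs n)) ->
  L2 mu D f -> L2 mu D g -> L2_cvg mu D fs f ->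
  (fun n => int (fun x => g x * fs n x)) @ \oo --> int (fun x => g x * f x).
Proof.
move=> fs2 f2 g2 /(L2_cvg_sqr fs2 f2) cv.
apply/cvgrPdist_lt => e e0.
set a := int (fun x => g x ^+ 2).
have a0 : 0 <= a by apply: Rintegral_ge0 => x _; exact: sqr_ge0.
have e1 : 0 < e ^+ 2 / (a + 1) by rewrite divr_gt0 ?exprn_gt0 //; lra.
move/cvgrPdist_lt : cv => /(_ _ e1); apply: filterS => n.
rewrite sub0r normrN ger0_norm; last first.
  by apply: Rintegral_ge0 => x _; exact: sqr_ge0.
rewrite ltr_pdivlMr; last lra.
move=> small; rewrite -RintegralB //; [|exact: L2M_integrable..].
rewrite (_ : Rintegral _ _ _ = - int (fun x => g x * (fs n x - f x)));
  last first.
  rewrite -mulN1r -RintegralZl //; last by apply: L2M_integrable => //;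
    exact: L2B.
  by apply: eq_Rintegral => x _; ring.
have := cauchy_schwarz g2 (L2B (fs2 n) f2).
set b := Rintegral _ _ _; set c := int (fun x =>
  (fs n x - f x) ^+ 2) in small *; rewrite -/a => bac.
have c0 : 0 <= c by apply: Rintegral_ge0 => x _; exact: sqr_ge0.
rewrite normrN -(ltr_pXn2r (n := 2)) // ?nnegrE ?(ltW e0) //.
rewrite -normrX ger0_norm ?sqr_ge0 //.
by apply: le_lt_trans bac _; apply: le_lt_trans small; nra.
Qed.

Lemma L2_sqr_eq0 f : L2 mu D f -> int (fun x => f x ^+ 2) = 0 ->
  ae_eq mu D f (cst 0).
Proof.
move=> f2 f0.
have mf := L2_measurable f2.
have : ae_eq mu D (fun x => (f x ^+ 2)%:E) (cst 0%E).
  apply/(ae_eq_integral_abs _ mD); first exact/measurable_EFinP/measurable_funX.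
  under eq_integral => x _ do rewrite /= ger0_norm ?sqr_ge0 //.
  rewrite -[LHS]fineK; first by rewrite [fine _]f0.
  exact: (integrable_fin_num mD (L2_sqr_integrable f2)).
apply: filterS => x /= + Dx => /(_ Dx) [] /eqP.
by rewrite sqrf_eq0 => /eqP.
Qed.

Lemma integral_sqrD_le f g : L2 mu D f -> L2 mu D g ->
  int (fun x => (f x + g x) ^+ 2) <=
  2 * int (fun x => f x ^+ 2) + 2 * int (fun x => g x ^+ 2).
Proof.
move=> f2 g2.
have i1 := L2_sqr_integrable f2; have i2 := L2_sqr_integrable g2.
rewrite -(RintegralZl _ mD i1) -(RintegralZl _ mD i2) -RintegralD //;
  last 2 first.
- exact: (integrableZl mD 2 i1).
- exact: (integrableZl mD 2 i2).
apply: le_Rintegral => //.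
- exact: (L2_sqr_integrable (L2D f2 g2)).
- exact: (integrableD mD (integrableZl mD 2 i1) (integrableZl mD 2 i2)).
- move=> x _; have := sqr_ge0 (f x - g x).
  by rewrite !expr2; nra.
Qed.

Lemma ae_eq_Rintegral f g : measurable_fun D f -> measurable_fun D g ->
  ae_eq mu D f g -> int f = int g.
Proof.
move=> mf mg fg; congr fine; apply: ae_eq_integral => //.
- exact/measurable_EFinP.
- exact/measurable_EFinP.
- by apply: filterS fg => x /= h Dx; rewrite h.
Qed.

End L2_theory.

(** * Measurability and C^1 functions in the plane *)

Local Notation plane R := (measurableTypeR R * measurableTypeR R)%type.

Section Plane_measurability.
Context {R : realType}.

(** The plane has a countable basis of open boxes with rational corners. *)
Lemma open_measurable_plane (A : set (R * R)) :
  open A -> measurable (A : set (plane R)).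
Proof.
move=> oA.
pose box (a b c d : rat) : set (plane R) :=
  `]ratr a, ratr b[%classic `*` `]ratr c, ratr d[%classic.
(* the boxes that are not contained in [A] are replaced by the empty set *)
pose B a b c d : set (plane R) :=
  if `[< box a b c d `<=` A >] then box a b c d else set0.
suff -> : A = \bigcup_a \bigcup_b \bigcup_c \bigcup_d B a b c d.
  do 4![apply: bigcupT_measurable_rat => ?].
  by rewrite /B; case: ifP => // _; exact: measurableX.
apply/seteqP; split=> [x Ax|x [a _ [b _ [c _ [d _]]]]]; last first.
  by rewrite /B; case: asboolP => // + ?; exact.
move: oA; rewrite openE => /(_ x Ax).
rewrite /interior => /nbhs_ballP[e /= e0 xe].
have rat_near (y : R) : exists a b : rat,
    (y \in `]ratr a, ratr b[) /\ forall z, z \in `]ratr a, ratr b[ ->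
      ball y e z.
  have /rat_in_itvoo[a /andP[a1 a2]] : y - e < y by rewrite ltrBlDr ltrDl.
  have /rat_in_itvoo[b /andP[b1 b2]] : y < y + e by rewrite ltrDl.
  rewrite !bnd_simp in a1 a2 b1 b2.
  exists a, b; split; first by rewrite in_itv /= a2.
  move=> z; rewrite in_itv /= => /andP[az zb].
  by rewrite /ball /= ltr_norml; apply/andP; split; lra.
have [a [b [xab abe]]] := rat_near x.1.
have [c [d [xcd cde]]] := rat_near x.2.
exists a => //; exists b => //; exists c => //; exists d => //.
rewrite /B; case: asboolP => [_|]; first by split.
case; move=> y [yab ycd]; apply: xe; split; [exact: abe|exact: cde].
Qed.

Lemma continuous_measurable_plane (U : set (R * R)) (f : R * R -> R) :
  open U -> (forall x, U x -> {for x, continuous f}) ->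
  measurable_fun (U : set (plane R)) f.
Proof.
move=> oU cf; apply: (measurability _ (RGenOpens.measurableE R)).
move=> _ [_ [a [b ->] <-]]; apply: open_measurable_plane.
rewrite openE => x [Ux fx]; apply: filterI; first exact: (open_nbhs_nbhs (conj
  oU Ux)).
by apply: (cf _ Ux); apply: open_nbhs_nbhs; split => //; exact: interval_open.
Qed.

End Plane_measurability.

Section C1.
Context {R : realType}.
Implicit Types (F G : R * R -> R) (U V : set (R * R)) (x : R * R).

Lemma Ck1P U F : Ck U 1 F <->
  forall x, U x -> [/\ {for x, continuous F}, derivable F x (1, 0),
    derivable F x (0, 1), {for x, continuous (dx F)} &
    {for x, continuous (dy F)}].
Proof.
split=> [[cF [dF [cFx _] [cFy _]]] x Ux|h].
  by have [] := dF _ Ux; split; [exact: cF| | |exact: cFx|exact: cFy].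
by split; [|split; [|split|split]] => // x /h[].
Qed.

Lemma Ck1S U V F : U `<=` V -> Ck V 1 F -> Ck U 1 F.
Proof. by move=> UV /Ck1P h; apply/Ck1P => x /UV /h. Qed.

Lemma near_continuous F G x : (\near x, F x = G x) ->
  {for x, continuous G} -> {for x, continuous F}.
Proof.
move=> FG cG; rewrite /prop_for /continuous_at (nbhs_singleton FG).
by apply: cvg_trans cG; apply: near_eq_cvg; near do apply/esym.
Unshelve. all: by end_near. Qed.

Let continuousB_at F G x : {for x, continuous F} -> {for x, continuous G} ->
  {for x, continuous (fun y => F y - G y)}.
Proof. exact: cvgB. Qed.

Let continuousMD_at F G F' G' x :
  {for x, continuous F} -> {for x, continuous G} ->
  {for x, continuous F'} -> {for x, continuous G'} ->
  {for x, continuous (fun y => F y * G' y + G y * F' y)}.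
Proof. by move=> ? ? ? ?; apply: cvgD; exact: cvgM. Qed.

Lemma Ck1B U F G : open U -> Ck U 1 F -> Ck U 1 G ->
  Ck U 1 (fun x => F x - G x) /\
  forall x, U x -> dx (fun x => F x - G x) x = dx F x - dx G x /\
                   dy (fun x => F x - G x) x = dy F x - dy G x.
Proof.
move=> oU /Ck1P hF /Ck1P hG.
have dE x : U x -> dx (fun x => F x - G x) x = dx F x - dx G x /\
                   dy (fun x => F x - G x) x = dy F x - dy G x.
  move=> Ux; have [_ Fx Fy _ _] := hF _ Ux; have [_ Gx Gy _ _] := hG _ Ux.
  by split; [exact: (deriveB Fx Gx)|exact: (deriveB Fy Gy)].
split=> //; apply/Ck1P => x Ux.
have [cF Fx Fy cFx cFy] := hF _ Ux; have [cG Gx Gy cGx cGy] := hG _ Ux.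
split.
- exact: cvgB.
- exact: (derivableB Fx Gx).
- exact: (derivableB Fy Gy).
- apply: (near_continuous _ (continuousB_at cFx cGx)).
  apply: filterS (open_nbhs_nbhs (conj oU Ux)) => y /dE [] //.
- apply: (near_continuous _ (continuousB_at cFy cGy)).
  apply: filterS (open_nbhs_nbhs (conj oU Ux)) => y /dE [] //.
Qed.

(** Leibniz's rule holds around each point of the open set [U], hence the
    partial derivatives of the product are continuous there. *)
Lemma Ck1M U F G : open U -> Ck U 1 F -> Ck U 1 G ->
  Ck U 1 (fun x => F x * G x) /\
  forall x, U x -> dx (fun x => F x * G x) x = F x * dx G x + G x * dx F x /\
                   dy (fun x => F x * G x) x = F x * dy G x + G x * dy F x.
Proof.
move=> oU /Ck1P hF /Ck1P hG.
have dE x : U x -> dx (fun x => F x * G x) x = F x * dx G x + G x * dx F x /\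
                   dy (fun x => F x * G x) x = F x * dy G x + G x * dy F x.
  move=> Ux; have [_ Fx Fy _ _] := hF _ Ux; have [_ Gx Gy _ _] := hG _ Ux.
  by split; [exact: (deriveM Fx Gx)|exact: (deriveM Fy Gy)].
split=> //; apply/Ck1P => x Ux.
have [cF Fx Fy cFx cFy] := hF _ Ux; have [cG Gx Gy cGx cGy] := hG _ Ux.
split.
- exact: cvgM.
- exact: (derivableM Fx Gx).
- exact: (derivableM Fy Gy).
- apply: (near_continuous _ (continuousMD_at cF cG cFx cGx)).
  apply: filterS (open_nbhs_nbhs (conj oU Ux)) => y /dE [] //.
- apply: (near_continuous _ (continuousMD_at cF cG cFy cGy)).
  apply: filterS (open_nbhs_nbhs (conj oU Ux)) => y /dE [] //.
Qed.

(** A partial derivative is the derivative of a function of one real variable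
    along a horizontal or vertical line, where the one-variable calculus
    applies. *)
Let slicex_quotient F x :
  (fun h : R => h^-1 *: ((F \o shift x) (h *: ((1, 0) : R * R)) - F x)) =
  (fun h : R => h^-1 *: (((fun t => F (t, x.2)) \o shift x.1) (h *: 1) -
    F (x.1, x.2))).
Proof.
apply/funext => h /=; rewrite -surjective_pairing; congr (_ *: (F _ - _)).
by case: x => a b; congr pair => /=; rewrite scaler0 add0r.
Qed.

Let slicey_quotient F x :
  (fun h : R => h^-1 *: ((F \o shift x) (h *: ((0, 1) : R * R)) - F x)) =
  (fun h : R => h^-1 *: (((fun t => F (x.1, t)) \o shift x.2) (h *: 1) -
    F (x.1, x.2))).
Proof.
apply/funext => h /=; rewrite -surjective_pairing; congr (_ *: (F _ - _)).
by case: x => a b; congr pair => /=; rewrite scaler0 add0r.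
Qed.

Lemma derivable_slicex F x : derivable F x (1, 0) ->
  is_derive x.1 1 (fun t => F (t, x.2)) (dx F x).
Proof. by rewrite /dx /derivable /derive slicex_quotient => dF; split. Qed.

Lemma derivable_slicey F x : derivable F x (0, 1) ->
  is_derive x.2 1 (fun t => F (x.1, t)) (dy F x).
Proof. by rewrite /dy /derivable /derive slicey_quotient => dF; split. Qed.

Lemma slicex_derivable F x l : is_derive x.1 1 (fun t => F (t, x.2)) l ->
  derivable F x (1, 0) /\ dx F x = l.
Proof. by case; rewrite /dx /derivable /derive slicex_quotient. Qed.

Lemma slicey_derivable F x l : is_derive x.2 1 (fun t => F (x.1, t)) l ->
  derivable F x (0, 1) /\ dy F x = l.
Proof. by case; rewrite /dy /derivable /derive slicey_quotient. Qed.

Lemma Ck1_fst U : Ck U 1 (@fst R R) /\ forall x,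
  dx (@fst R R) x = 1 /\ dy (@fst R R) x = 0.
Proof.
have hx x : derivable (@fst R R) x (1, 0) /\ dx (@fst R R) x = 1.
  exact: slicex_derivable.
have hy x : derivable (@fst R R) x (0, 1) /\ dy (@fst R R) x = 0.
  by apply: slicey_derivable; exact: is_derive_cst.
split; last by move=> x; rewrite (hx x).2 (hy x).2.
apply/Ck1P => x _; split; [exact: cvg_fst|exact: (hx x).1|exact: (hy x).1| |].
- by rewrite (_ : dx _ = cst 1); [exact: cvg_cst|apply/funext => y;
    exact: (hx y).2].
- by rewrite (_ : dy _ = cst 0); [exact: cvg_cst|apply/funext => y;
    exact: (hy y).2].
Qed.

Lemma Ck1_snd U : Ck U 1 (@snd R R) /\ forall x,
  dx (@snd R R) x = 0 /\ dy (@snd R R) x = 1.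
Proof.
have hx x : derivable (@snd R R) x (1, 0) /\ dx (@snd R R) x = 0.
  by apply: slicex_derivable; exact: is_derive_cst.
have hy x : derivable (@snd R R) x (0, 1) /\ dy (@snd R R) x = 1.
  exact: slicey_derivable.
split; last by move=> x; rewrite (hx x).2 (hy x).2.
apply/Ck1P => x _; split; [exact: cvg_snd|exact: (hx x).1|exact: (hy x).1| |].
- by rewrite (_ : dx _ = cst 0); [exact: cvg_cst|apply/funext => y;
    exact: (hx y).2].
- by rewrite (_ : dy _ = cst 1); [exact: cvg_cst|apply/funext => y;
    exact: (hy y).2].
Qed.

End C1.

(** * The annulus *)

(** The squared radius is a polynomial, so radial functions are written
    [h \o nsq] rather than [h \o polar_r]: they are as smooth as [h] wherever
    [nsq] is positive. *)
Definition nsq {R : realType} (x : R * R) : R := x.1 ^+ 2 + x.2 ^+ 2.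

Section Annulus.
Context {R : realType}.
Variables (r1 r2 : R).
Hypotheses (r1_gt0 : 0 < r1) (lt_r12 : r1 < r2).
Implicit Types (x : R * R) (F : R * R -> R).

Local Notation Omega := (annulus r1 r2).
Local Notation K := (closure Omega).
Local Notation mu := (@lebesgue_measure R).

Let r2_gt0 : 0 < r2. Proof. exact: lt_trans lt_r12. Qed.

Lemma nsq_ge0 x : 0 <= nsq x.
Proof. by rewrite addr_ge0 // sqr_ge0. Qed.

Lemma polar_r_ge0 x : 0 <= polar_r x.
Proof. exact: sqrtr_ge0. Qed.

Lemma polar_r_sqr x : polar_r x ^+ 2 = nsq x.
Proof. by rewrite sqr_sqrtr // nsq_ge0. Qed.

Lemma annulusE x : Omega x <-> r1 ^+ 2 < nsq x < r2 ^+ 2.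
Proof.
rewrite /annulus /= -polar_r_sqr !ltr_pXn2r //; rewrite nnegrE ?polar_r_ge0 //;
  exact: ltW.
Qed.

Lemma nsq_continuous : continuous (@nsq R).
Proof.
move=> x; rewrite /nsq; apply: cvgD.
- by apply: (@cvgM _ _ _ _ (@fst R R) (@fst R R)); exact: cvg_fst.
- by apply: (@cvgM _ _ _ _ (@snd R R) (@snd R R)); exact: cvg_snd.
Qed.

Lemma nsq_circle (rho theta : R) : nsq (circle rho theta) = rho ^+ 2.
Proof.
by rewrite /nsq /circle /= !exprMn -mulrDr cos2Dsin2 mulr1.
Qed.

Lemma open_annulus : open Omega.
Proof.
have -> : Omega = @nsq R @^-1` `]r1 ^+ 2, r2 ^+ 2[.
  by apply/seteqP; split=> x /=; rewrite in_itv /= => /annulusE.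
apply: open_comp; last exact: interval_open.
by move=> x _; exact: nsq_continuous.
Qed.

Lemma closure_annulus : K = [set x | r1 ^+ 2 <= nsq x <= r2 ^+ 2].
Proof.
apply/seteqP; split=> [|x /= /andP[lo hi]].
  have cK : closed [set x | r1 ^+ 2 <= nsq x <= r2 ^+ 2].
    rewrite (_ : mkset _ = @nsq R @^-1` `[r1 ^+ 2, r2 ^+ 2]); last first.
      by apply/seteqP; split=> x /=; rewrite in_itv.
    by apply: preimage_closed; [move=> x _; exact: nsq_continuous|exact:
      itv_closed].
  move/closure_id : cK => ->; apply: closure_subset =>
    x /annulusE /andP[? ?] /=.
  by rewrite !ltW.
(* every point of the closed annulus is a limit of points of the same ray *)
have ray t : nsq (t * x.1, t * x.2) = t ^+ 2 * nsq x.
  by rewrite /nsq /= !exprMn mulrDr.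
have ray_cvg : (t * x.1, t * x.2) @[t --> (1 : R)] --> x.
  rewrite [X in _ --> X](_ : x = (1 * x.1, 1 * x.2));
    last by case: x {lo hi ray} => a b; rewrite !mul1r.
  have h (a : R) : t * a @[t --> (1 : R)] --> 1 * a.
    by apply: cvgMr_tmp; exact: cvg_id.
  exact: (cvg_pair (h x.1) (h x.2)).
move=> B xB; have BEr := cvg_at_right_filter ray_cvg xB;
  have BEl := cvg_at_left_filter ray_cvg xB.
have s0 : 0 < nsq x by apply: lt_le_trans lo; rewrite exprn_gt0.
(* the points of the inner circle are pushed outwards, the others inwards *)
have [lo'|hi'] := leP (nsq x) (r1 ^+ 2).
- have xE : nsq x = r1 ^+ 2 by apply/eqP; rewrite eq_le lo' lo.
  have lt12 : 1 < r2 / r1 by rewrite ltr_pdivlMr // mul1r.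
  have : \forall t \near 1^'+, B (t * x.1, t * x.2) /\ 1 < t < r2 / r1.
    near=> t; split; last first.
      by apply/andP; split; near: t; [exact: nbhs_right_gt|exact:
        nbhs_right_lt].
    by near: t; exact: BEr.
  move=> /filter_ex[t [Bt /andP[t1 t2]]]; exists (t * x.1, t * x.2);
    split => //.
  apply/annulusE; rewrite ray xE -exprMn.
  have t0 : 0 < t by exact: lt_trans t1.
  have [p0 q0 m0] : [/\ 0 <= r1, 0 <= r2 & 0 <= t * r1].
    by split; [exact: ltW|exact: ltW|rewrite mulr_ge0 // ltW].
  apply/andP; split; rewrite ltr_pXn2r //; first by rewrite ltr_pMl.
  by rewrite -ltr_pdivlMr.
- have r1s : r1 < polar_r x.
    by rewrite -(@ltr_pXn2r _ 2) // ?nnegrE ?polar_r_ge0 ?(ltW r1_gt0) //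
      polar_r_sqr.
  have ps : 0 < polar_r x by exact: lt_trans r1s.
  have lt12 : r1 / polar_r x < 1 by rewrite ltr_pdivrMr // mul1r.
  have : \forall t \near 1^'-, B (t * x.1, t * x.2) /\ r1 / polar_r x < t < 1.
    near=> t; split; last first.
      by apply/andP; split; near: t; [exact: nbhs_left_gt|exact: nbhs_left_lt].
    by near: t; exact: BEl.
  move=> /filter_ex[t [Bt /andP[t1 t2]]]; exists (t * x.1, t * x.2);
    split => //.
  have t0 : 0 < t by apply: lt_trans t1; rewrite divr_gt0.
  apply/annulusE; rewrite ray; apply/andP; split.
    rewrite -polar_r_sqr -exprMn ltr_pXn2r // ?nnegrE ?(ltW r1_gt0) //.
      by rewrite -ltr_pdivrMr.
    by rewrite mulr_ge0 // ltW.
  by apply: lt_le_trans hi; rewrite gtr_pMl // expr_lt1 // ltW.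
Unshelve. all: by end_near. Qed.

Lemma annulus_closureP x : K x <-> r1 ^+ 2 <= nsq x <= r2 ^+ 2.
Proof. by rewrite closure_annulus. Qed.

Lemma circle1_closure theta : K (circle r1 theta).
Proof.
by apply/annulus_closureP; rewrite nsq_circle lexx ltW //
  ltr_pXn2r ?nnegrE ?ltW.
Qed.

Lemma circle2_closure theta : K (circle r2 theta).
Proof.
by apply/annulus_closureP; rewrite nsq_circle lexx ltW //
  ltr_pXn2r ?nnegrE ?ltW.
Qed.

Let sub_box : K `<=` `[- r2, r2]%classic `*` `[- r2, r2]%classic.
Proof.
move=> x /annulus_closureP /andP[_ hi].
have bnd (a : R) : a ^+ 2 <= r2 ^+ 2 -> - r2 <= a <= r2.
  move=> h; rewrite -ler_norml -(@ler_pXn2r _ 2) // ?nnegrE //; last exact: ltW.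
  by rewrite -normrX ger0_norm // sqr_ge0.
by split => /=; rewrite in_itv /=; apply: bnd; apply: le_trans hi;
  rewrite /nsq ?lerDl ?lerDr sqr_ge0.
Qed.

Lemma compact_closure_annulus : compact K.
Proof.
apply: (subclosed_compact _ _ sub_box); first exact: closed_closure.
by apply: compact_setX; exact: segment_compact.
Qed.

Lemma continuous_bounded F : (forall x, K x -> {for x, continuous F}) ->
  exists M, forall x, K x -> `|F x| <= M.
Proof.
move=> cF.
have cFK : {within K, continuous F}.
  by apply: continuous_in_subspaceT => x; rewrite inE; exact: cF.
have [M [_ hM]] := compact_bounded (continuous_compact cFK
  compact_closure_annulus).
exists (M + 1) => x Kx; apply: (hM (M + 1)); first by rewrite ltrDl.
by exists x.
Qed.

Lemma measurable_annulus : measurable (Omega : set (plane R)).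
Proof. exact: open_measurable_plane open_annulus. Qed.

Lemma annulus_finite : (leb2 R (Omega : set (plane R)) < +oo)%E.
Proof.
have mbox : measurable (`[- r2, r2]%classic `*` `[- r2,
  r2]%classic : set (plane R)).
  by apply: measurableX; exact: measurable_itv.
apply: (@le_lt_trans _ _ (leb2 R (`[- r2, r2]%classic `*` `[- r2,
  r2]%classic : set (plane R)))).
  apply: le_measure; rewrite ?inE //; first exact: measurable_annulus.
  by apply: subset_trans sub_box; exact: subset_closure.
rewrite product_measure1E; [|exact: measurable_itv..].
pose I : set R := `[- r2, r2]%classic.
have fin : (mu I < +oo)%E.
  by rewrite lebesgue_measure_itv /=; case: ifP => _; rewrite ?ltry.
by rewrite lte_mul_pinfty // ge0_fin_numE.
Qed.

Lemma continuous_L2 F : (forall x, K x -> {for x, continuous F}) ->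
  L2 (leb2 R) (Omega : set (plane R)) F.
Proof.
move=> cF; have [M hM] := continuous_bounded cF.
apply: (@bounded_L2 _ _ _ _ _ measurable_annulus _ M).
- exact: annulus_finite.
- apply: continuous_measurable_plane; first exact: open_annulus.
  by move=> x Ox; apply: cF; exact: subset_closure.
- by move=> x Ox; apply: hM; exact: subset_closure.
Qed.

Lemma measurable_angles : measurable (@angles R : set (measurableTypeR R)).
Proof. exact: measurable_itv. Qed.

Lemma angles_finite : (mu (@angles R) < +oo)%E.
Proof. by rewrite lebesgue_measure_itv /=; case: ifP => _; rewrite ltry. Qed.

Lemma circle_continuous (rho : R) : continuous (circle rho).
Proof.
move=> t.
have c : rho * cos z @[z --> t] --> rho * cos t.
  by apply: cvgMl_tmp; exact: continuous_cos.
have s : rho * sin z @[z --> t] --> rho * sin t.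
  by apply: cvgMl_tmp; exact: continuous_sin.
exact: (cvg_pair c s).
Qed.

Lemma continuous_circle_L2 F rho :
  (forall t, {for circle rho t, continuous F}) ->
  L2 mu angles (F \o circle rho).
Proof.
move=> cF.
have cFc : continuous (F \o circle rho).
  by move=> t; apply: continuous_comp; [exact: circle_continuous|exact: cF].
have cFa : {within `[0, 2 * pi], continuous (F \o circle rho)}.
  exact: continuous_subspaceT.
have [M [_ hM]] := compact_bounded (continuous_compact cFa (@segment_compact R
  _ _)).
apply: (@bounded_L2 _ _ R mu _ measurable_angles (F \o circle rho) (M + 1)).
- exact: angles_finite.
- by apply: measurable_funTS; exact: continuous_measurable_fun.
- by move=> x Ox; apply: (hM (M + 1)); [rewrite ltrDl|exists x].
Qed.

End Annulus.

(** * Integration on the line *)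

Section Calculus1D.
Context {R : realType}.
Implicit Types (a b c t y : R) (f G phi : R -> R).
Local Notation mu := (@lebesgue_measure R).

Lemma continuous_itv_integrable f a b :
  (forall t, a <= t <= b -> {for t, continuous f}) ->
  mu.-integrable `[a, b] (EFin \o f).
Proof.
move=> cf; apply: continuous_compact_integrable; first exact: segment_compact.
by apply: continuous_in_subspaceT => t; rewrite inE /= in_itv /=; exact: cf.
Qed.

(** Regularity is required only when [a < b]: this covers the chords of
    length zero of the lines that do not meet a circle. *)
Lemma FTC_itvoo f f' a b : a <= b ->
  (a < b -> forall t, a <= t <= b -> is_derive t 1 f (f' t) /\
                                     {for t, continuous f'}) ->
  (\int[mu]_(t in `]a, b[) (f' t)%:E = (f b - f a)%:E)%E.
Proof.
rewrite le_eqVlt => /predU1P[-> _|ab /(_ ab) df].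
  by rewrite set_itv_ge ?bnd_simp ?ltxx // integral_set0 subrr.
have mf : measurable_fun `[a, b] (EFin \o f').
  by apply: (measurable_int mu); apply: continuous_itv_integrable => t /df[].
have cvf t : a <= t <= b -> f s @[s --> t] --> f t.
  move=> /df[dft _]; apply: differentiable_continuous.
  exact/derivable1_diffP/(@ex_derive _ _ _ _ _ _ _ dft).
rewrite integral_itv_obnd_cbnd; last first.
  apply: measurable_funS mf => //.
  exact: subset_itv_oo_cc.
rewrite integral_itv_bndo_bndc; last first.
  apply: measurable_funS mf => //.
  exact: subset_itv_co_cc.
rewrite (@continuous_FTC2 _ f' f) //.
- by apply: continuous_in_subspaceT => t; rewrite inE /= in_itv /= => /df[].
- split.
  + move=> t; rewrite in_itv /= => /andP[at_ tb].
    by have [[]] : is_derive t 1 f (f' t) /\ {for t, continuous f'}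
      by apply: df; rewrite !ltW.
  + by apply: cvg_at_right_filter; apply: cvf; rewrite lexx ltW.
  + by apply: cvg_at_left_filter; apply: cvf; rewrite lexx ltW.
- move=> t; rewrite in_itv /= => /andP[at_ tb].
  have [[_ <-] _] : is_derive t 1 f (f' t) /\ {for t, continuous f'}.
    by apply: df; rewrite !ltW.
  by rewrite derive1E.
Qed.

Lemma Rintegral_itv_cat f a b c : a <= b <= c ->
  mu.-integrable `[a, c] (EFin \o f) ->
  \int[mu]_(t in `[a, c]) f t =
  \int[mu]_(t in `[a, b]) f t + \int[mu]_(t in `[b, c]) f t.
Proof.
move=> /andP[ab bc] fi; rewrite -(@Rintegral_itv_obnd_cbnd _ b); last first.
  by apply: integrableS fi => //; apply: subset_itvr; rewrite bnd_simp.
rewrite -(@Rintegral_itvB _ _ (BLeft a) (BRight c) b) ?bnd_simp //.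
by rewrite addrC subrK.
Qed.

Section substitution.
Variables (phi phi' : R -> R) (a b : R).
Hypotheses (le_ab : a <= b) (dphi : forall t, is_derive t 1 phi (phi' t))
  (cphi' : continuous phi').

Let phi'E : derive1 phi = phi'.
Proof. by apply/funext => t; rewrite derive1E; have [_ ->] := dphi t. Qed.

Let cphi : continuous phi.
Proof.
move=> t; apply/differentiable_continuous/derivable1_diffP.
exact: (@ex_derive _ _ _ _ _ _ _ (dphi t)).
Qed.

Let phiLR : derivable_oo_LRcontinuous phi a b.
Proof.
split; first by move=> t _; exact: (@ex_derive _ _ _ _ _ _ _ (dphi t)).
- by apply: cvg_at_right_filter; exact: cphi.
- by apply: cvg_at_left_filter; exact: cphi.
Qed.

Lemma increasing_substitution G :
  {in `[a, b] &, {homo phi : x y / x < y}} ->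
  (forall y, phi a <= y <= phi b -> {for y, continuous G}) ->
  \int[mu]_(y in `[phi a, phi b]) G y =
  \int[mu]_(t in `[a, b]) (G (phi t) * phi' t).
Proof.
move=> incr cG; congr fine.
rewrite integration_by_substitution_increasing ?phi'E //.
- by apply/cvg_ex; exists (phi' a); apply: cvg_at_right_filter; exact: cphi'.
- by apply/cvg_ex; exists (phi' b); apply: cvg_at_left_filter; exact: cphi'.
- by apply: continuous_in_subspaceT => y; rewrite inE /= in_itv /=; exact: cG.
Qed.

Lemma decreasing_substitution G :
  {in `[a, b] &, {homo phi : x y /~ x < y}} ->
  (forall y, phi b <= y <= phi a -> {for y, continuous G}) ->
  \int[mu]_(y in `[phi b, phi a]) G y =
  \int[mu]_(t in `[a, b]) (G (phi t) * - phi' t).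
Proof.
move=> decr cG; congr fine.
rewrite integration_by_substitution_decreasing ?phi'E //.
- by apply/cvg_ex; exists (phi' a); apply: cvg_at_right_filter; exact: cphi'.
- by apply/cvg_ex; exists (phi' b); apply: cvg_at_left_filter; exact: cphi'.
- by apply: continuous_in_subspaceT => y; rewrite inE /= in_itv /=; exact: cG.
Qed.

End substitution.

Lemma sqrtr_ltl c t : 0 < t -> (Num.sqrt c < t) = (c < t ^+ 2).
Proof.
move=> t0; rewrite -[in LHS](gtr0_norm t0) -sqrtr_sqr ltr_sqrt //.
by rewrite exprn_gt0.
Qed.

Lemma sqrtr_ltr c t : 0 < t -> (t < Num.sqrt c) = (t ^+ 2 < c).
Proof.
move=> t0; have [c0|c0] := ltP 0 c.
  by rewrite -[in LHS](gtr0_norm t0) -sqrtr_sqr ltr_sqrt.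
rewrite ler0_sqrtr // ltNge ltW //= ltNge.
by rewrite (le_trans c0) // sqr_ge0.
Qed.

(** The section of an annulus by a line at distance [|y|] from its centre is
    [|t|] between [sqrt (r1^2 - y^2)] and [sqrt (r2^2 - y^2)], up to the point
    [t = 0]; as [Num.sqrt] vanishes on negative reals, this covers the lines
    that miss the inner circle, or both circles. *)
Lemma slice_integral r1 r2 f f' y : 0 < r1 -> r1 < r2 ->
  (forall t, r1 ^+ 2 <= t ^+ 2 + y ^+ 2 <= r2 ^+ 2 ->
    is_derive t 1 f (f' t) /\ {for t, continuous f'}) ->
  let a := Num.sqrt (r1 ^+ 2 - y ^+ 2) in
  let b := Num.sqrt (r2 ^+ 2 - y ^+ 2) in
  (\int[mu]_(t in [set t | (r1 ^+ 2 < t ^+ 2 + y ^+ 2 < r2 ^+ 2)%R]) (f' t)%:E =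
   ((f b - f (- b)) - (f a - f (- a)))%:E)%E.
Proof.
move=> r10 r12 df a b; set S := [set t | _].
have a0 : 0 <= a by exact: sqrtr_ge0.
have b0 : 0 <= b by exact: sqrtr_ge0.
have r12s : r1 ^+ 2 < r2 ^+ 2 by rewrite ltr_pXn2r // nnegrE ltW //
  (lt_trans r10).
have ab : a <= b.
  have [h|h] := ltP 0 (r2 ^+ 2 - y ^+ 2).
    by apply: ler_wsqrtr; rewrite lerD2r ltW.
  by rewrite /a ler0_sqrtr ?b0 //; apply: le_trans h; rewrite lerD2r ltW.
have pos t : 0 < t -> S t <-> a < t < b.
  by move=> t0; rewrite /S /= sqrtr_ltl // sqrtr_ltr // ltrBlDr ltrBrDr.
have SE : S `\ 0 = `]a, b[ `|` `]- b, - a[.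
  apply/seteqP; split=> t /=.
    move=> [St /eqP]; rewrite neq_lt => /orP[t0|t0].
      right; have : S (- t) by rewrite /S /= sqrrN.
      by move=> /pos; rewrite oppr_gt0 => /(_ t0);
        rewrite in_itv /= ltrNl ltrNr andbC.
    by left; move/pos : St => /(_ t0); rewrite in_itv.
  rewrite !in_itv /= => -[/andP[at_ tb]|/andP[bt ta]].
    have t0 : 0 < t by exact: le_lt_trans at_.
    by split; [apply/(pos _ t0); rewrite at_|apply/eqP; rewrite gt_eqF].
  have t0 : t < 0 by apply: lt_le_trans ta _; rewrite oppr_le0.
  split; last by apply/eqP; rewrite lt_eqF.
  have : S (- t) by apply/pos; rewrite ?oppr_gt0 // ltrNr ta ltrNl bt.
  by rewrite /S /= sqrrN.
have dfp : a < b -> forall t, a <= t <= b -> is_derive t 1 f (f' t) /\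
                                     {for t, continuous f'}.
  move=> altb t /andP[at_ tb]; apply: df.
  have bp : 0 < b by exact: le_lt_trans altb.
  have t0 : 0 <= t by exact: le_trans at_.
  have b2 : b ^+ 2 = r2 ^+ 2 - y ^+ 2.
    by rewrite sqr_sqrtr // ltW // -sqrtr_gt0.
  apply/andP; split.
    rewrite -lerBlDr; have [h|h] := leP 0 (r1 ^+ 2 - y ^+ 2).
      by rewrite -(sqr_sqrtr h) ler_pXn2r // nnegrE.
    by rewrite (le_trans (ltW h)) // sqr_ge0.
  by rewrite -lerBrDr -b2 ler_pXn2r // nnegrE.
have dfm : - b < - a -> forall t, - b <= t <= - a -> is_derive t 1 f (f' t) /\
                                     {for t, continuous f'}.
  rewrite ltrN2 => altb t /andP[bt ta]; apply: df.
  have bp : 0 < b by exact: le_lt_trans altb.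
  have t0 : 0 <= - t by apply: le_trans a0 _; rewrite lerNr.
  have b2 : b ^+ 2 = r2 ^+ 2 - y ^+ 2.
    by rewrite sqr_sqrtr // ltW // -sqrtr_gt0.
  rewrite -(sqrrN t); apply/andP; split.
    rewrite -lerBlDr; have [h|h] := leP 0 (r1 ^+ 2 - y ^+ 2).
      by rewrite -(sqr_sqrtr h) ler_pXn2r // ?nnegrE // lerNr.
    by rewrite (le_trans (ltW h)) // sqr_ge0.
  by rewrite -lerBrDr -b2 ler_pXn2r // ?nnegrE // lerNl.
have mU : measurable_fun (`]a, b[%classic `|` `]- b, - a[%classic) f'.
  apply/measurable_funU; [exact: measurable_itv..|split].
  - apply: open_continuous_measurable_fun; first exact: interval_open.
    move=> t; rewrite inE /= in_itv /= => /andP[at_ tb].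
    by apply: (dfp _ _ _).2; [exact: lt_trans tb|rewrite !ltW].
  - apply: open_continuous_measurable_fun; first exact: interval_open.
    move=> t; rewrite inE /= in_itv /= => /andP[at_ tb].
    by apply: (dfm _ _ _).2; [exact: lt_trans tb|rewrite !ltW].
have mIU : measurable (`]a, b[%classic `|` `]- b,
  - a[%classic : set (measurableTypeR R)).
  by apply: measurableU; exact: measurable_itv.
rewrite -(@integral_setD1 _ _ 0 S); rewrite SE //; last exact/measurable_EFinP.
rewrite integral_setU //; [|exact: measurable_itv..| |].
- rewrite (FTC_itvoo ab dfp) (FTC_itvoo _ dfm) ?lerN2 // -EFinD; congr EFin;
    ring.
- exact/measurable_EFinP.
- apply/disj_setPS => t [] /=; rewrite !in_itv /= => /andP[at_ _] /andP[_ ta].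
  have : t < t by apply: lt_trans at_; apply: (lt_le_trans ta); lra.
  by rewrite ltxx.
Qed.

End Calculus1D.

(** * The flux through a circle *)

Section Circle_flux.
Context {R : realType}.
Local Notation mu := (@lebesgue_measure R).
Implicit Types (t y : R).

Lemma pair_continuous (f g : R -> R) t : {for t, continuous f} ->
  {for t, continuous g} -> {for t, continuous (fun s => (f s, g s))}.
Proof. exact: cvg_pair. Qed.

Lemma chord_continuous (r : R) :
  continuous (fun y => Num.sqrt (r ^+ 2 - y ^+ 2)).
Proof.
move=> y; apply: (@continuous_comp _ _ _ (fun y =>
  r ^+ 2 - y ^+ 2) (@Num.sqrt R)).
  by apply: cvgB; [exact: cvg_cst|exact: exprn_continuous].
exact: sqrt_continuous.
Qed.

Lemma nsq_chord (r y : R) : - r <= y <= r ->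
  Num.sqrt (r ^+ 2 - y ^+ 2) ^+ 2 + y ^+ 2 = r ^+ 2.
Proof.
move=> /andP[ry yr]; rewrite sqr_sqrtr ?subrK // subr_sqr.
by apply: mulr_ge0; lra.
Qed.

Variables (r : R) (F : R * R -> R).
Hypotheses (r_gt0 : 0 < r)
  (cF : forall x, nsq x = r ^+ 2 -> {for x, continuous F}).

Let ge_r : 0 <= r. Proof. exact: ltW. Qed.

Let circle_cont (h : R -> R) : continuous h ->
  continuous (fun t => F (circle r t) * (r * h t)).
Proof.
move=> ch t; apply: cvgM; last by apply: cvgMl_tmp; exact: ch.
apply: (@continuous_comp _ _ _ (circle r) F); first exact: circle_continuous.
by apply: cF; exact: nsq_circle.
Qed.

Let circle_integrable (h : R -> R) a b : continuous h ->
  mu.-integrable `[a, b] (EFin \o (fun t => F (circle r t) * (r * h t))).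
Proof.
by move=> ch; apply: continuous_itv_integrable => t _; exact: circle_cont.
Qed.

(** The two ends of a chord are obtained for [e = 1] and [e = - 1]. *)
Lemma signed_chord_continuous (e y : R) : e ^+ 2 = 1 -> - r <= y <= r ->
  {for y, continuous (fun y => F (e * Num.sqrt (r ^+ 2 - y ^+ 2), y))} /\
  {for y, continuous (fun y => F (y, e * Num.sqrt (r ^+ 2 - y ^+ 2)))}.
Proof.
move=> e2 yr.
have cc : {for y, continuous (fun y => e * Num.sqrt (r ^+ 2 - y ^+ 2))}.
  by apply: cvgMl_tmp; exact: chord_continuous.
split.
- apply: (@continuous_comp _ _ _
    (fun y => (e * Num.sqrt (r ^+ 2 - y ^+ 2), y)) F).
    by apply: pair_continuous => //; exact: cvg_id.
  by apply: cF; rewrite /nsq /= exprMn e2 mul1r nsq_chord.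
- apply: (@continuous_comp _ _ _
    (fun y => (y, e * Num.sqrt (r ^+ 2 - y ^+ 2))) F).
    by apply: pair_continuous => //; exact: cvg_id.
  by apply: cF; rewrite /nsq /= exprMn e2 mul1r addrC nsq_chord.
Qed.

Let plus_chord y : - r <= y <= r ->
  {for y, continuous (fun y => F (Num.sqrt (r ^+ 2 - y ^+ 2), y))} /\
  {for y, continuous (fun y => F (y, Num.sqrt (r ^+ 2 - y ^+ 2)))}.
Proof.
move=> /(@signed_chord_continuous 1 y (expr1n _ _)) [c1 c2].
have E z : Num.sqrt (r ^+ 2 - z ^+ 2) = 1 * Num.sqrt (r ^+ 2 - z ^+ 2).
  by rewrite mul1r.
split.
- by rewrite (_ : (fun y => _) =
      (fun y => F (1 * Num.sqrt (r ^+ 2 - y ^+ 2), y)));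
    last by apply/funext => z; rewrite -E.
- by rewrite (_ : (fun y => _) =
      (fun y => F (y, 1 * Num.sqrt (r ^+ 2 - y ^+ 2))));
    last by apply/funext => z; rewrite -E.
Qed.

Let minus_chord y : - r <= y <= r ->
  {for y, continuous (fun y => F (- Num.sqrt (r ^+ 2 - y ^+ 2), y))} /\
  {for y, continuous (fun y => F (y, - Num.sqrt (r ^+ 2 - y ^+ 2)))}.
Proof.
have e1 : (-1) ^+ 2 = 1 :> R by rewrite sqrrN expr1n.
move=> /(@signed_chord_continuous (-1) y e1) [c1 c2].
have E z : - Num.sqrt (r ^+ 2 - z ^+ 2) = -1 * Num.sqrt (r ^+ 2 - z ^+ 2).
  by rewrite mulN1r.
split.
- by rewrite (_ : (fun y => _) =
      (fun y => F (-1 * Num.sqrt (r ^+ 2 - y ^+ 2), y)));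
    last by apply/funext => z; rewrite E.
- by rewrite (_ : (fun y => _) =
      (fun y => F (y, -1 * Num.sqrt (r ^+ 2 - y ^+ 2))));
    last by apply/funext => z; rewrite E.
Qed.

Let dsin t : is_derive t 1 (fun t => r * sin t) (r * cos t).
Proof.
have := is_deriveZ r (is_derive_sin t).
by rewrite /GRing.scale.
Qed.

Let dcos t : is_derive t 1 (fun t => r * cos t) (r * - sin t).
Proof.
have := is_deriveZ r (is_derive_cos t).
by rewrite /GRing.scale.
Qed.

Let crcos : continuous (fun t => r * cos t).
Proof. by move=> t; apply: cvgMl_tmp; exact: continuous_cos. Qed.

Let crNsin : continuous (fun t => r * - sin t).
Proof. by move=> t; apply: cvgMl_tmp; apply: cvgN; exact: continuous_sin. Qed.

Let sinBpi t : sin (t - pi) = - sin t.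
Proof. by rewrite sinB cospi sinpi mulrN1 mulr0 subr0. Qed.

Let cosBpi t : cos (t - pi) = - cos t.
Proof. by rewrite cosB cospi sinpi mulrN1 mulr0 addr0. Qed.

Let sinB2pi t : sin (t - 2 * pi) = sin t.
Proof. by rewrite mulr_natl sinB cos2pi sin2pi mulr1 mulr0 subr0. Qed.

Let cosB2pi t : cos (t - 2 * pi) = cos t.
Proof. by rewrite mulr_natl cosB cos2pi sin2pi mulr1 mulr0 addr0. Qed.

Let sqrt_sin t : Num.sqrt (r ^+ 2 - (r * sin t) ^+ 2) = r * `|cos t|.
Proof.
rewrite exprMn -{1}[r ^+ 2]mulr1 -mulrBr -cos2sin2 sqrtrM ?sqr_ge0 //.
by rewrite !sqrtr_sqr ger0_norm.
Qed.

Let sqrt_cos t : Num.sqrt (r ^+ 2 - (r * cos t) ^+ 2) = r * `|sin t|.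
Proof.
rewrite exprMn -{1}[r ^+ 2]mulr1 -mulrBr -sin2cos2 sqrtrM ?sqr_ge0 //.
by rewrite !sqrtr_sqr ger0_norm.
Qed.

(** On the half-circle [x >= 0], the ordinate [y = r sin t] increases with [t],
    over [[0, pi / 2]] for its upper part and [[3 pi / 2, 2 pi]] for its lower
    part; on the half-circle [x <= 0] it decreases over
    [[pi / 2, 3 pi / 2]]. The sign of [dy = r cos t dt] is thus the sign with
    which each end of the chord occurs. *)
Lemma flux_x :
  \int[mu]_(y in `[- r, r]) (F (Num.sqrt (r ^+ 2 - y ^+ 2), y) -
                             F (- Num.sqrt (r ^+ 2 - y ^+ 2), y)) =
  r * \int[mu]_(t in angles) (F (circle r t) * cos t).
Proof.
have pi0 := pi_gt0 R.
have ip : mu.-integrable `[- r, r]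
  (EFin \o (fun y => F (Num.sqrt (r ^+ 2 - y ^+ 2), y))).
  by apply: continuous_itv_integrable => y /plus_chord[].
have im : mu.-integrable `[- r, r]
  (EFin \o (fun y => F (- Num.sqrt (r ^+ 2 - y ^+ 2), y))).
  by apply: continuous_itv_integrable => y /minus_chord[].
have right_upper : \int[mu]_(y in `[0, r]) F (Num.sqrt (r ^+ 2 - y ^+ 2), y) =
    \int[mu]_(t in `[0, pi / 2]) (F (circle r t) * (r * cos t)).
  rewrite [LHS](_ : _ = \int[mu]_(y in `[r * sin 0, r * sin (pi / 2)])
      F (Num.sqrt (r ^+ 2 - y ^+ 2), y));
    last by rewrite sin0 mulr0 sin_pihalf mulr1.
  rewrite (increasing_substitution _ dsin crcos); first last.
  - move=> y; rewrite sin0 mulr0 sin_pihalf mulr1 => /andP[y0 yr].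
    by apply: (plus_chord _).1; rewrite yr (le_trans _ y0) // oppr_le0.
  - move=> s t; rewrite !in_itv /= => /andP[s0 s1] /andP[t0 t1] st.
    by rewrite ltr_pM2l // ltr_sin // in_itv /=; lra.
  - lra.
  apply: eq_Rintegral => t; rewrite inE /= in_itv /= => /andP[t0 t1].
  rewrite sqrt_sin ger0_norm // cos_ge0_pihalf //; lra.
have right_lower : \int[mu]_(y in `[- r, 0]) F (Num.sqrt (r ^+ 2 - y ^+ 2), y) =
    \int[mu]_(t in `[3 * (pi / 2), 2 * pi]) (F (circle r t) * (r * cos t)).
  have s3 : sin (3 * (pi / 2)) = -1 :> R.
    by rewrite -sinB2pi (_ : _ - _ = - (pi / 2)) ?sinN ?sin_pihalf //; field.
  have s4 : sin (2 * pi) = 0 :> R by rewrite mulr_natl sin2pi.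
  rewrite [LHS](_ : _ =
      \int[mu]_(y in `[r * sin (3 * (pi / 2)), r * sin (2 * pi)])
      F (Num.sqrt (r ^+ 2 - y ^+ 2), y)); last by rewrite s3 s4 mulrN1 mulr0.
  rewrite (increasing_substitution _ dsin crcos); first last.
  - move=> y; rewrite s3 s4 mulrN1 mulr0 => /andP[yr y0].
    by apply: (plus_chord _).1; rewrite yr (le_trans y0).
  - move=> s t; rewrite !in_itv /= => /andP[s0 s1] /andP[t0 t1] st.
    rewrite ltr_pM2l // -(sinB2pi s) -(sinB2pi t) ltr_sin // ?in_itv /=; lra.
  - lra.
  apply: eq_Rintegral => t; rewrite inE /= in_itv /= => /andP[t0 t1].
  rewrite sqrt_sin ger0_norm // -cosB2pi cos_ge0_pihalf //; lra.
have left : \int[mu]_(y in `[- r, r]) F (- Num.sqrt (r ^+ 2 - y ^+ 2), y) =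
    - \int[mu]_(t in `[pi / 2, 3 * (pi / 2)]) (F (circle r t) * (r * cos t)).
  have s3 : sin (3 * (pi / 2)) = -1 :> R.
    by rewrite -sinB2pi (_ : _ - _ = - (pi / 2)) ?sinN ?sin_pihalf //; field.
  rewrite [LHS](_ : _ =
      \int[mu]_(y in `[r * sin (3 * (pi / 2)), r * sin (pi / 2)])
      F (- Num.sqrt (r ^+ 2 - y ^+ 2), y));
    last by rewrite s3 sin_pihalf mulrN1 mulr1.
  rewrite (decreasing_substitution _ dsin crcos); first last.
  - move=> y; rewrite s3 sin_pihalf mulrN1 mulr1 => yr.
    exact: (minus_chord yr).1.
  - move=> s t; rewrite !in_itv /= => /andP[s0 s1] /andP[t0 t1] st.
    rewrite ltr_pM2l // -[sin t]opprK -[sin s]opprK ltrN2 -!sinBpi.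
    rewrite ltr_sin // ?in_itv /=; lra.
  - lra.
  rewrite -mulN1r -RintegralZl //; last first.
    by apply: circle_integrable; exact: continuous_cos.
  apply: eq_Rintegral => t; rewrite inE /= in_itv /= => /andP[t0 t1].
  rewrite sqrt_sin ler0_norm; last first.
    by rewrite -[cos t]opprK -cosBpi oppr_le0 cos_ge0_pihalf //; lra.
  by rewrite !mulrN opprK mulN1r.
rewrite RintegralB // left opprK (@Rintegral_itv_cat _ _ _ 0) //;
  last by rewrite oppr_le0 ge_r.
rewrite right_upper right_lower.
have ci a b := circle_integrable a b (@continuous_cos R).
rewrite -RintegralZl; [|exact: measurable_angles|]; last first.
  apply: continuous_itv_integrable => t _; apply: cvgM;
    last exact: continuous_cos.
  apply: (@continuous_comp _ _ _ (circle r) F); first exact: circle_continuous.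
  by apply: cF; exact: nsq_circle.
rewrite [RHS](@eq_Rintegral _ _ R mu _ (fun t =>
  F (circle r t) * (r * cos t))); last first.
  by move=> t _; rewrite mulrCA.
rewrite /angles (@Rintegral_itv_cat _ _ 0 (pi / 2) (2 * pi) _ (ci _ _));
  last by apply/andP; split; lra.
rewrite (@Rintegral_itv_cat _ _ (pi / 2) (3 * (pi / 2)) (2 * pi) _ (ci _ _));
  last by apply/andP; split; lra.
by rewrite -addrA addrC -addrA.
Qed.

(** The abscissa [r cos t] decreases on the upper half-circle, [0 <= t <= pi],
    and increases on the lower one, [pi <= t <= 2 pi]. *)
Lemma flux_y :
  \int[mu]_(y in `[- r, r]) (F (y, Num.sqrt (r ^+ 2 - y ^+ 2)) -
                             F (y, - Num.sqrt (r ^+ 2 - y ^+ 2))) =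
  r * \int[mu]_(t in angles) (F (circle r t) * sin t).
Proof.
have pi0 := pi_gt0 R.
have ip : mu.-integrable `[- r, r]
  (EFin \o (fun y => F (y, Num.sqrt (r ^+ 2 - y ^+ 2)))).
  by apply: continuous_itv_integrable => y /plus_chord[].
have im : mu.-integrable `[- r, r]
  (EFin \o (fun y => F (y, - Num.sqrt (r ^+ 2 - y ^+ 2)))).
  by apply: continuous_itv_integrable => y /minus_chord[].
have upper : \int[mu]_(y in `[- r, r]) F (y, Num.sqrt (r ^+ 2 - y ^+ 2)) =
    \int[mu]_(t in `[0, pi]) (F (circle r t) * (r * sin t)).
  rewrite [LHS](_ : _ = \int[mu]_(y in `[r * cos pi, r * cos 0])
      F (y, Num.sqrt (r ^+ 2 - y ^+ 2)));
    last by rewrite cos0 cospi mulrN1 mulr1.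
  rewrite (decreasing_substitution _ dcos crNsin); first last.
  - move=> y; rewrite cos0 cospi mulrN1 mulr1 => yr.
    exact: (plus_chord yr).2.
  - move=> s t sI tI st.
    by rewrite ltr_pM2l // ltr_cos.
  - exact: ltW.
  apply: eq_Rintegral => t; rewrite inE /= in_itv /= => tI.
  by rewrite sqrt_cos ger0_norm ?sin_ge0_pi // !mulrN opprK.
have lower : \int[mu]_(y in `[- r, r]) F (y, - Num.sqrt (r ^+ 2 - y ^+ 2)) =
    - \int[mu]_(t in `[pi, 2 * pi]) (F (circle r t) * (r * sin t)).
  have c2 : cos (2 * pi) = 1 :> R by rewrite mulr_natl cos2pi.
  rewrite [LHS](_ : _ = \int[mu]_(y in `[r * cos pi, r * cos (2 * pi)])
      F (y, - Num.sqrt (r ^+ 2 - y ^+ 2)));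
    last by rewrite c2 cospi mulrN1 mulr1.
  rewrite (increasing_substitution _ dcos crNsin); first last.
  - move=> y; rewrite c2 cospi mulrN1 mulr1 => yr.
    exact: (minus_chord yr).2.
  - move=> s t; rewrite !in_itv /= => /andP[s0 s1] /andP[t0 t1] st.
    rewrite ltr_pM2l // -[cos t]opprK -[cos s]opprK ltrN2 -!cosBpi.
    rewrite ltr_cos // ?in_itv /=; lra.
  - lra.
  rewrite -mulN1r -RintegralZl //; last first.
    by apply: circle_integrable; exact: continuous_sin.
  apply: eq_Rintegral => t; rewrite inE /= in_itv /= => /andP[t0 t1].
  rewrite sqrt_cos ler0_norm; last first.
    by rewrite -[sin t]opprK -sinBpi oppr_le0 sin_ge0_pi //; lra.
  by rewrite !mulrN opprK mulN1r.
rewrite RintegralB // upper lower opprK.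
have ci a b := circle_integrable a b (@continuous_sin R).
rewrite -RintegralZl; [|exact: measurable_angles|]; last first.
  apply: continuous_itv_integrable => t _; apply: cvgM;
    last exact: continuous_sin.
  apply: (@continuous_comp _ _ _ (circle r) F); first exact: circle_continuous.
  by apply: cF; exact: nsq_circle.
rewrite [RHS](@eq_Rintegral _ _ R mu _ (fun t =>
  F (circle r t) * (r * sin t))); last first.
  by move=> t _; rewrite mulrCA.
by rewrite /angles (@Rintegral_itv_cat _ _ 0 pi (2 * pi) _ (ci _ _)) //;
  apply/andP; split; lra.
Qed.

End Circle_flux.

(** * The divergence theorem on the annulus *)

Section Divergence.
Context {R : realType}.
Variables (r1 r2 : R).
Hypotheses (r1_gt0 : 0 < r1) (lt_r12 : r1 < r2).
Local Notation mu := (@lebesgue_measure R).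
Local Notation Omega := (annulus r1 r2).
Local Notation K := (closure (annulus r1 r2)).
Implicit Types (F : R * R -> R) (t y : R).

Let r2_gt0 : 0 < r2. Proof. exact: lt_trans lt_r12. Qed.

Lemma C1_closureP F : C1_closure Omega F -> forall x, K x ->
  [/\ {for x, continuous F}, derivable F x (1, 0),
    derivable F x (0, 1), {for x, continuous (dx F)} &
    {for x, continuous (dy F)}].
Proof. by case=> U [_ KU /Ck1P h] x /KU /h. Qed.

(** The lines that miss the circle cut chords of length zero, which contribute
    nothing. *)
Let integral_chord (B : R -> R) (r : R) : 0 < r ->
  mu.-integrable `[- r, r] (EFin \o B) ->
  (forall y, r ^+ 2 <= y ^+ 2 -> B y = 0) ->
  mu.-integrable setT (EFin \o B) /\
  \int[mu]_y B y = \int[mu]_(y in `[- r, r]) B y.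
Proof.
move=> r0 Bi B0.
have BE : B = B \_ `[- r, r].
  apply/funext => y; rewrite patchE; case: ifPn => // /negP yr.
  apply: B0; apply: contra_notT yr; rewrite -ltNge => yr;
    rewrite inE /= in_itv /=.
  by rewrite -ler_norml -(@ler_pXn2r _ 2) // ?nnegrE ?ltW //
    -normrX ger0_norm ?sqr_ge0 // ltW.
split; last by rewrite [RHS]Rintegral_mkcond -BE.
move: Bi => /integrable_mkcond -/(_ (measurable_itv _)).
by rewrite restrict_EFin -BE.
Qed.

Let chord_flux (B1 B2 : R -> R) :
  mu.-integrable `[- r1, r1] (EFin \o B1) ->
  (forall y, r1 ^+ 2 <= y ^+ 2 -> B1 y = 0) ->
  mu.-integrable `[- r2, r2] (EFin \o B2) ->
  (forall y, r2 ^+ 2 <= y ^+ 2 -> B2 y = 0) ->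
  fine (\int[mu]_y (B2 y - B1 y)%:E)%E =
  \int[mu]_(y in `[- r2, r2]) B2 y - \int[mu]_(y in `[- r1, r1]) B1 y.
Proof.
move=> B1i B10 B2i B20.
have [i1 <-] := integral_chord r1_gt0 B1i B10.
have [i2 <-] := integral_chord r2_gt0 B2i B20.
by rewrite -RintegralB.
Qed.

Let chord0 (r y : R) : r ^+ 2 <= y ^+ 2 -> Num.sqrt (r ^+ 2 - y ^+ 2) = 0.
Proof. by move=> ry; rewrite ler0_sqrtr // subr_le0. Qed.

Let on_circle F : C1_closure Omega F ->
  (forall x, nsq x = r1 ^+ 2 -> {for x, continuous F}) /\
  (forall x, nsq x = r2 ^+ 2 -> {for x, continuous F}).
Proof.
have h : r1 ^+ 2 <= r2 ^+ 2 by rewrite ler_pXn2r ?nnegrE ?ltW.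
move=> /C1_closureP F1; split=> x xr.
- have [|c _ _ _ _] := F1 x; last exact: c.
  by apply/annulus_closureP; rewrite // xr lexx.
- have [|c _ _ _ _] := F1 x; last exact: c.
  by apply/annulus_closureP; rewrite // xr lexx h.
Qed.

Let chord_integrable F (r : R) :
  (forall x, nsq x = r ^+ 2 -> {for x, continuous F}) ->
  forall e : R, e ^+ 2 = 1 ->
  mu.-integrable `[- r, r]
    (EFin \o (fun y : R => F (e * Num.sqrt (r ^+ 2 - y ^+ 2), y))) /\
  mu.-integrable `[- r, r]
    (EFin \o (fun y : R => F (y, e * Num.sqrt (r ^+ 2 - y ^+ 2)))).
Proof.
move=> cF e e1; split; apply: continuous_itv_integrable => y yr;
  by have [cx cy] := signed_chord_continuous cF e1 yr.
Qed.

Let chord_diff_integrable F (r : R) :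
  (forall x, nsq x = r ^+ 2 -> {for x, continuous F}) ->
  mu.-integrable `[- r, r]
    (EFin \o (fun y : R => F (Num.sqrt (r ^+ 2 - y ^+ 2), y) -
                           F (- Num.sqrt (r ^+ 2 - y ^+ 2), y))) /\
  mu.-integrable `[- r, r]
    (EFin \o (fun y : R => F (y, Num.sqrt (r ^+ 2 - y ^+ 2)) -
                           F (y, - Num.sqrt (r ^+ 2 - y ^+ 2)))).
Proof.
move=> cF.
have [px py] := chord_integrable cF (expr1n _ _).
have [mx my] := chord_integrable cF (etrans (sqrrN 1) (expr1n _ _)).
have mI : measurable (`[- r, r]%classic : set (measurableTypeR R)).
  exact: measurable_itv.
split.
- have := integrableB mI px mx.
  by apply: eq_integrable => // y _; rewrite /= mul1r mulN1r.
- have := integrableB mI py my.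
  by apply: eq_integrable => // y _; rewrite /= mul1r mulN1r.
Qed.

(** The sections of the annulus by lines, in the form of
    [slice_integral]. *)
Let slice_patch (f : R * R -> R) (x y : R) :
  ((EFin \o f) \_ (Omega : set (plane R))) (x, y) =
  ((fun t => (f (t, y))%:E) \_
     [set t | r1 ^+ 2 < t ^+ 2 + y ^+ 2 < r2 ^+ 2]) x /\
  ((EFin \o f) \_ (Omega : set (plane R))) (x, y) =
  ((fun t => (f (x, t))%:E) \_
     [set t | r1 ^+ 2 < t ^+ 2 + x ^+ 2 < r2 ^+ 2]) y.
Proof.
split; rewrite !patchE; case: ifPn => xy; case: ifPn => // xy'.
- by move: xy'; rewrite notin_setE; case; move: xy; rewrite inE => /annulusE;
    exact.
- by move: xy; rewrite notin_setE; case; apply/annulusE => //; move: xy';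
    rewrite inE.
- move: xy'; rewrite notin_setE; case; move: xy; rewrite inE => /annulusE.
  by rewrite /nsq /= addrC; exact.
- move: xy; rewrite notin_setE; case; apply/annulusE => //; move: xy';
    rewrite inE.
  by rewrite /nsq /= addrC.
Qed.

Let finite_annulus := annulus_finite r1_gt0 lt_r12.

(** Half of the divergence theorem on the annulus: on each horizontal line,
    the fundamental theorem of calculus leaves the values of [F] at the ends
    of the chords cut by the two circles; the chords of one circle, summed over
    [y = r sin theta], give the flux through that circle. *)
Lemma integral_dx F : C1_closure Omega F ->
  \int[leb2 R]_(x in Omega) dx F x =
  r2 * \int[mu]_(t in angles) (F (circle r2 t) * cos t) -
  r1 * \int[mu]_(t in angles) (F (circle r1 t) * cos t).
Proof.
move=> F1; have [c1 c2] := on_circle F1.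
have Fx := C1_closureP F1.
have i1 := (chord_diff_integrable c1).1.
have i2 := (chord_diff_integrable c2).1.
rewrite -(flux_x r1_gt0 c1) -(flux_x r2_gt0 c2) -chord_flux //; first last.
- by move=> y /chord0 ->; rewrite oppr0 subrr.
- by move=> y /chord0 ->; rewrite oppr0 subrr.
have mO := measurable_annulus r1_gt0 lt_r12.
have dFi : (leb2 R).-integrable Omega (EFin \o dx F).
  apply: (L2_integrable mO) => //.
  by apply: continuous_L2 => // x /Fx[_ _ _ cx _]; exact: cx.
rewrite /Rintegral integral_mkcond -integral21_prod_meas1; last first.
  exact/(integrable_mkcond _ mO).
congr fine; apply: eq_integral => y _; rewrite /fubini_G.
under eq_integral => x _ do rewrite (slice_patch _ x y).1.
rewrite -integral_mkcond.
rewrite (slice_integral (f := fun t => F (t, y)) r1_gt0 lt_r12) // => t ty.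
have [|_ dFx _ cFx _] := Fx (t, y); first exact/annulus_closureP.
split; first exact: (derivable_slicex dFx).
apply: (@continuous_comp _ _ _ (fun t => (t, y)) (dx F)) => //.
by apply: pair_continuous; [exact: cvg_id|exact: cvg_cst].
Qed.

(** The other half, on vertical lines. *)
Lemma integral_dy F : C1_closure Omega F ->
  \int[leb2 R]_(x in Omega) dy F x =
  r2 * \int[mu]_(t in angles) (F (circle r2 t) * sin t) -
  r1 * \int[mu]_(t in angles) (F (circle r1 t) * sin t).
Proof.
move=> F1; have [c1 c2] := on_circle F1.
have Fx := C1_closureP F1.
have i1 := (chord_diff_integrable c1).2.
have i2 := (chord_diff_integrable c2).2.
rewrite -(flux_y r1_gt0 c1) -(flux_y r2_gt0 c2) -chord_flux //; first last.
- by move=> y /chord0 ->; rewrite oppr0 subrr.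
- by move=> y /chord0 ->; rewrite oppr0 subrr.
have mO := measurable_annulus r1_gt0 lt_r12.
have dFi : (leb2 R).-integrable Omega (EFin \o dy F).
  apply: (L2_integrable mO) => //.
  by apply: continuous_L2 => // x /Fx[_ _ _ _ cy]; exact: cy.
rewrite /Rintegral integral_mkcond -integral12_prod_meas1; last first.
  exact/(integrable_mkcond _ mO).
congr fine; apply: eq_integral => x _; rewrite /fubini_F.
under eq_integral => y _ do rewrite (slice_patch _ x y).2.
rewrite -integral_mkcond.
rewrite (slice_integral (f := fun t => F (x, t)) r1_gt0 lt_r12) // => t ty.
have [|_ _ dFy _ cFy] := Fx (x, t).
  by apply/annulus_closureP; rewrite // /nsq /= addrC.
split; first exact: (derivable_slicey dFy).
apply: (@continuous_comp _ _ _ (fun t => (x, t)) (dy F)) => //.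
by apply: pair_continuous; [exact: cvg_cst|exact: cvg_id].
Qed.

End Divergence.

(** * Green's formula for radial functions *)

Section Radial.
Context {R : realType}.
Implicit Types (h k : R -> R) (x : R * R) (s t : R).

(** The derivatives of [h] are given as functions, so that Laplacians and normal
    derivatives of [h \o nsq] are explicit expressions. Positive reals are the
    squared radii of the points where radial functions are smooth. *)
Definition C2_pos h h' h'' := forall s : R, 0 < s ->
  [/\ is_derive s 1 h (h' s), is_derive s 1 h' (h'' s) &
      {for s, continuous h''}].

Definition punctured : set (R * R) := [set x | 0 < nsq x].

Lemma open_punctured : open punctured.
Proof.
rewrite (_ : punctured = @nsq R @^-1` `]0, +oo[); last first.
  by apply/seteqP; split=> x; rewrite /punctured /= in_itv /= andbT.
apply: open_comp; last exact: interval_open.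
by move=> x _; exact: nsq_continuous.
Qed.

Lemma derive_continuous (f : R -> R) s l : is_derive s 1 f l ->
  {for s, continuous f}.
Proof.
move=> df; apply/differentiable_continuous/derivable1_diffP.
exact: (@ex_derive _ _ _ _ _ _ _ df).
Qed.

Lemma radial_continuous k x : {for nsq x, continuous k} ->
  {for x, continuous (k \o @nsq R)}.
Proof. by move=> ck; apply: continuous_comp; [exact: nsq_continuous|]. Qed.

Lemma radial_C1 h h' :
  (forall s : R, 0 < s -> is_derive s 1 h (h' s) /\ {for s, continuous h'}) ->
  Ck punctured 1 (h \o @nsq R) /\
  forall x, punctured x ->
    dx (h \o @nsq R) x = 2 * x.1 * h' (nsq x) /\
    dy (h \o @nsq R) x = 2 * x.2 * h' (nsq x).
Proof.
move=> dh.
have dX x : punctured x -> derivable (h \o @nsq R) x (1, 0) /\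
    dx (h \o @nsq R) x = 2 * x.1 * h' (nsq x).
  move=> /dh [dhx _]; apply: slicex_derivable.
  have dq : is_derive x.1 1 (fun t : R => t ^+ 2 + x.2 ^+ 2) (2 * x.1).
    have := is_deriveD (is_deriveX 2 (is_derive_id x.1 (1 : R)))
      (is_derive_cst (x.2 ^+ 2) x.1 (1 : R)).
    by move=> H; apply: (is_derive_eq H); rewrite addr0 /GRing.scale /= mulr1
      expr1.
  have := @is_derive1_comp R h (fun t : R => t ^+ 2 + x.2 ^+ 2) x.1 _ _ dhx dq.
  by move=> H; apply: (is_derive_eq H); rewrite mulrC.
have dY x : punctured x -> derivable (h \o @nsq R) x (0, 1) /\
    dy (h \o @nsq R) x = 2 * x.2 * h' (nsq x).
  move=> /dh [dhx _]; apply: slicey_derivable.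
  have dq : is_derive x.2 1 (fun t : R => x.1 ^+ 2 + t ^+ 2) (2 * x.2).
    have := is_deriveD (is_derive_cst (x.1 ^+ 2) x.2 (1 : R))
      (is_deriveX 2 (is_derive_id x.2 (1 : R))).
    by move=> H; apply: (is_derive_eq H); rewrite add0r /GRing.scale /= mulr1
      expr1.
  have := @is_derive1_comp R h (fun t : R => x.1 ^+ 2 + t ^+ 2) x.2 _ _ dhx dq.
  by move=> H; apply: (is_derive_eq H); rewrite mulrC.
split; last by move=> x px; rewrite (dX _ px).2 (dY _ px).2.
apply/Ck1P => x px; have [dhx chx] := dh _ px.
have c2 (c : R * R -> R) : {for x, continuous c} ->
    {for x, continuous (fun y => 2 * c y * h' (nsq y))}.
  move=> cc; apply: cvgM; last exact: (radial_continuous chx).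
  by apply: cvgMl_tmp; exact: cc.
split.
- by apply: radial_continuous; exact: derive_continuous dhx.
- exact: (dX _ px).1.
- exact: (dY _ px).1.
- apply: (near_continuous _ (c2 (@fst R R) _)); last exact: cvg_fst.
  by apply: filterS (open_nbhs_nbhs (conj open_punctured px)) => y /dX [].
- apply: (near_continuous _ (c2 (@snd R R) _)); last exact: cvg_snd.
  by apply: filterS (open_nbhs_nbhs (conj open_punctured px)) => y /dY [].
Qed.

End Radial.

Section Green.
Context {R : realType}.
Variables (r1 r2 : R).
Hypotheses (r1_gt0 : 0 < r1) (lt_r12 : r1 < r2).
Local Notation mu := (@lebesgue_measure R).
Local Notation Omega := (annulus r1 r2).
Local Notation K := (closure (annulus r1 r2)).
Implicit Types (F v : R * R -> R) (x : R * R) (h : R -> R).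

Let r2_gt0 : 0 < r2. Proof. exact: lt_trans lt_r12. Qed.

Lemma closure_annulus_punctured : K `<=` @punctured R.
Proof.
move=> x /annulus_closureP => /(_ r1_gt0 lt_r12) /andP[+ _].
by apply: lt_le_trans; rewrite exprn_gt0.
Qed.

Lemma punctured_C1_closure F : Ck (@punctured R) 1 F -> C1_closure Omega F.
Proof.
by exists punctured; split => //; [exact: open_punctured|exact:
  closure_annulus_punctured].
Qed.

Lemma C1_closureM F v : C1_closure Omega F -> C1_closure Omega v ->
  C1_closure Omega (fun x => F x * v x) /\
  forall x, K x -> dx (fun x => F x * v x) x = F x * dx v x + v x * dx F x /\
                   dy (fun x => F x * v x) x = F x * dy v x + v x * dy F x.
Proof.
move=> [U [oU KU FU]] [V [oV KV vV]].
have oUV := openI oU oV.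
have [C1 C2] := Ck1M oUV (Ck1S (@subIsetl _ U V) FU) (Ck1S (@subIsetr _ U V)
  vV).
split; first by exists (U `&` V); split => // x Kx; split;
  [exact: KU|exact: KV].
by move=> x Kx; apply: C2; split; [exact: KU|exact: KV].
Qed.

Lemma C1_closureB F v : C1_closure Omega F -> C1_closure Omega v ->
  C1_closure Omega (fun x => F x - v x) /\
  forall x, K x -> dx (fun x => F x - v x) x = dx F x - dx v x /\
                   dy (fun x => F x - v x) x = dy F x - dy v x.
Proof.
move=> [U [oU KU FU]] [V [oV KV vV]].
have oUV := openI oU oV.
have [C1 C2] := Ck1B oUV (Ck1S (@subIsetl _ U V) FU) (Ck1S (@subIsetr _ U V)
  vV).
split; first by exists (U `&` V); split => // x Kx; split;
  [exact: KU|exact: KV].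
by move=> x Kx; apply: C2; split; [exact: KU|exact: KV].
Qed.

Lemma C1_closure_fst : C1_closure Omega (@fst R R).
Proof.
by exists setT; split; [exact: openT|exact: subsetT|exact: (Ck1_fst _).1].
Qed.

Lemma C1_closure_snd : C1_closure Omega (@snd R R).
Proof.
by exists setT; split; [exact: openT|exact: subsetT|exact: (Ck1_snd _).1].
Qed.

Lemma C1_L2 F : C1_closure Omega F ->
  [/\ L2 (leb2 R) Omega F, L2 (leb2 R) Omega (dx F) & L2 (leb2 R) Omega (dy F)].
Proof.
move=> /(C1_closureP) FC; split; apply: continuous_L2 =>
  // x /FC [c0 _ _ c1 c2].
- exact: c0.
- exact: c1.
- exact: c2.
Qed.

Lemma C1_circle_L2 F : C1_closure Omega F ->
  L2 mu angles (F \o circle r1) /\ L2 mu angles (F \o circle r2).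
Proof.
move=> /(C1_closureP) FC; split; apply: continuous_circle_L2 => t.
- by have [c0 _ _ _ _] := FC _ (@circle1_closure R r1 r2 r1_gt0 lt_r12 t);
    exact: c0.
- by have [c0 _ _ _ _] := FC _ (@circle2_closure R r1 r2 r1_gt0 lt_r12 t);
    exact: c0.
Qed.

Let mO : measurable (Omega : set (plane R)).
Proof. exact: measurable_annulus. Qed.
Let fO : (leb2 R (Omega : set (plane R)) < +oo)%E.
Proof. exact: annulus_finite. Qed.

(** The support of a test function is contained in the open annulus. *)
Lemma test_function_circle phi t : test_function Omega phi ->
  phi (circle r1 t) = 0 /\ phi (circle r2 t) = 0.
Proof.
move=> [_ _ sub].
have notO rho : (rho == r1) || (rho == r2) -> phi (circle rho t) = 0.
  move=> rE; apply/eqP; apply: contraT => ph.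
  have : Omega (circle rho t) by apply: sub; exact: subset_closure.
  move/(annulusE r1_gt0 lt_r12); rewrite nsq_circle.
  by case/orP : rE => /eqP ->; rewrite ltxx ?andbF.
by split; apply: notO; rewrite eqxx ?orbT.
Qed.

(** The classical gradient is a weak gradient: by the divergence theorem the
    integral of a derivative of [F * phi] is a flux through the two circles,
    where [phi] vanishes. *)
Lemma C1_H1 F : C1_closure Omega F -> H1 r1 r2 F (fun x => (dx F x, dy F x)).
Proof.
move=> FC; have [F2 Fx2 Fy2] := C1_L2 FC.
split; [exact: F2|exact: Fx2|exact: Fy2|] => phi tphi.
have phiC : C1_closure Omega phi.
  by exists setT; split; [exact: openT|exact: subsetT|have [+ _ _] := tphi;
    exact].
have [p2 px2 py2] := C1_L2 phiC.
have [C E] := C1_closureM FC phiC.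
have dX := integral_dx r1_gt0 lt_r12 C.
have dY := integral_dy r1_gt0 lt_r12 C.
have z (rho : R) (f : R -> R) : (forall t, phi (circle rho t) = 0) ->
    \int[mu]_(t in angles) (F (circle rho t) * phi (circle rho t) * f t) = 0.
  move=> p0; under eq_Rintegral do rewrite p0 mulr0 mul0r.
  by rewrite /Rintegral integral0.
have z1 t := (test_function_circle t tphi).1.
have z2 t := (test_function_circle t tphi).2.
rewrite !z // !mulr0 subrr in dX dY.
have split_int (F' p' d : R * R -> R) : L2 (leb2 R) Omega F' ->
  L2 (leb2 R) Omega p' ->
    (forall x, K x -> d x = F x * p' x + phi x * F' x) ->
    \int[leb2 R]_(x in Omega) d x = 0 ->
    \int[leb2 R]_(x in Omega) (F x * p' x) =
    - \int[leb2 R]_(x in Omega) (F' x * phi x).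
  move=> F'2 p'2 dE d0; apply/eqP; rewrite -addr_eq0; apply/eqP.
  rewrite -RintegralD //; [|exact: L2M_integrable..].
  rewrite -[RHS]d0; apply: eq_Rintegral => x; rewrite inE => Ox.
  by rewrite dE 1?[phi x * _]mulrC //; exact: subset_closure.
by split; [apply: (split_int _ _ _ Fx2 px2 _ dX)|apply: (split_int _ _ _ Fy2
  py2 _ dY)] => x /E[].
Qed.

Lemma L2_cvg_cst d (T : measurableType d) (m : {measure set T -> \bar R}) D f :
  L2_cvg m D (fun=> f) f.
Proof.
rewrite /L2_cvg (_ : (fun _ => _) = (fun=> 0%E)); first exact: cvg_cst.
apply/funext => n; rewrite (_ : EFin \o _ = cst 0%E) ?Lnorm0 //.
apply/funext => x /=; rewrite patchE; case: ifP => //= _.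
by rewrite subrr.
Qed.

(** The constant sequence [F] is admissible in the definition of the trace. *)
Lemma C1_trace F : C1_closure Omega F ->
  is_trace r1 r2 F (fun x => (dx F x, dy F x)) F.
Proof.
move=> FC; have [c1 c2] := C1_circle_L2 FC; split => //.
by exists (fun=> F); split; [|exact: L2_cvg_cst|split;
  exact: L2_cvg_cst|exact: L2_cvg_cst..].
Qed.

Section radial_function.
Variables (h h' h'' : R -> R).
Hypothesis hC2 : C2_pos h h' h''.

Let dh : forall s : R, 0 < s ->
  is_derive s 1 h (h' s) /\ {for s, continuous h'}.
Proof.
by move=> s /hC2 [h0 h1 h2]; split => //; exact: derive_continuous h1.
Qed.

Let dh' : forall s : R, 0 < s ->
  is_derive s 1 h' (h'' s) /\ {for s, continuous h''}.
Proof. by move=> s /hC2 []. Qed.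

Lemma radial_C1_closure : C1_closure Omega (h \o @nsq R).
Proof. exact: punctured_C1_closure (radial_C1 dh).1. Qed.

Let h'C1 : C1_closure Omega (h' \o @nsq R).
Proof. exact: punctured_C1_closure (radial_C1 dh').1. Qed.

(** The Laplacian of [h (x^2 + y^2)] is [4 h' + 4 (x^2 + y^2) h''], and its
    derivative along the unit radial vector is [2 r h'(r^2)]. This is the
    divergence theorem for the field [v grad U], where [U = h (x^2 + y^2)]. *)
Lemma radial_green v : C1_closure Omega v ->
  \int[leb2 R]_(x in Omega) (dx (h \o @nsq R) x * dx v x +
                             dy (h \o @nsq R) x * dy v x) =
  - (\int[leb2 R]_(x in Omega)
      ((4 * h' (nsq x) + 4 * nsq x * h'' (nsq x)) * v x)) +
  2 * r2 * h' (r2 ^+ 2) * circle_int r2 v -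
  2 * r1 * h' (r1 ^+ 2) * circle_int r1 v.
Proof.
move=> vC.
have gradU x : K x -> dx (h \o @nsq R) x = 2 * x.1 * h' (nsq x) /\
    dy (h \o @nsq R) x = 2 * x.2 * h' (nsq x).
  by move=> /closure_annulus_punctured; exact: (radial_C1 dh).2.
have [wC wE] := C1_closureM h'C1 vC.
have [xC xE] := C1_closureM C1_closure_fst wC.
have [yC yE] := C1_closureM C1_closure_snd wC.
have dX := integral_dx r1_gt0 lt_r12 xC.
have dY := integral_dy r1_gt0 lt_r12 yC.
have [v2 vx2 vy2] := C1_L2 vC.
have [_ xx2 _] := C1_L2 xC; have [_ _ yy2] := C1_L2 yC.
have [U2 Ux2 Uy2] := C1_L2 radial_C1_closure.
have lapC : L2 (leb2 R) Omega
    (fun x => 4 * h' (nsq x) + 4 * nsq x * h'' (nsq x)).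
  apply: continuous_L2 => // x /closure_annulus_punctured px.
  have [_ ch'] := dh px; have [_ ch''] := dh' px.
  apply: cvgD; first by apply: cvgMl_tmp; exact: (radial_continuous ch').
  apply: cvgM; last exact: (radial_continuous ch'').
  by apply: cvgMl_tmp; exact: nsq_continuous.
(* on each circle, [v grad U / 2] has radial component [rho h'(rho^2) v] *)
have flux (rho : R) : L2 mu angles (v \o circle rho) ->
    \int[mu]_(t in angles) ((circle rho t).1 *
      (h' (nsq (circle rho t)) * v (circle rho t)) * cos t) +
    \int[mu]_(t in angles) ((circle rho t).2 *
      (h' (nsq (circle rho t)) * v (circle rho t)) * sin t) =
    h' (rho ^+ 2) * circle_int rho v.
  move=> vL; rewrite /circle_int mulrA.
  have cos2_L2 : L2 mu angles (fun t : R => rho * h' (rho ^+ 2) * cos t ^+ 2).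
    apply: (@bounded_L2 _ _ R mu _ measurable_angles _
      (`|rho * h' (rho ^+ 2)|)).
    - exact: angles_finite.
    - apply: measurable_funM => //; apply: measurable_funX.
      by apply: measurable_funTS; apply: continuous_measurable_fun;
        exact: continuous_cos.
    - move=> s _ /=; rewrite normrM ler_piMr // normrX.
      by rewrite expr_le1 // cos_max.
  have sin2_L2 : L2 mu angles (fun t : R => rho * h' (rho ^+ 2) * sin t ^+ 2).
    apply: (@bounded_L2 _ _ R mu _ measurable_angles _
      (`|rho * h' (rho ^+ 2)|)).
    - exact: angles_finite.
    - apply: measurable_funM => //; apply: measurable_funX.
      by apply: measurable_funTS; apply: continuous_measurable_fun;
        exact: continuous_sin.
    - move=> s _ /=; rewrite normrM ler_piMr // normrX.
      by rewrite expr_le1 // sin_max.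
  have ma := @measurable_angles R.
  rewrite (@eq_Rintegral _ _ _ mu _ (fun t =>
    rho * h' (rho ^+ 2) * cos t ^+ 2 * v (circle rho t))); last first.
    by move=> t _; rewrite nsq_circle /circle /=; ring.
  rewrite [X in _ + X](@eq_Rintegral _ _ _ mu _ (fun t =>
    rho * h' (rho ^+ 2) * sin t ^+ 2 * v (circle rho t))); last first.
    by move=> t _; rewrite nsq_circle /circle /=; ring.
  rewrite -RintegralD //; last 2 first.
  - exact: (L2M_integrable ma cos2_L2 vL).
  - exact: (L2M_integrable ma sin2_L2 vL).
  rewrite -RintegralZl //; last first.
    by apply: (L2_integrable ma) => //; exact: angles_finite.
  apply: eq_Rintegral => t _; rewrite -mulrDl -mulrDr cos2Dsin2; ring.
have [vc1 vc2] := C1_circle_L2 vC.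
have F1 := flux _ vc1; have F2 := flux _ vc2.
have iD : \int[leb2 R]_(x in Omega) (dx (h \o @nsq R) x * dx v x +
                             dy (h \o @nsq R) x * dy v x) +
  \int[leb2 R]_(x in Omega) ((4 * h' (nsq x) + 4 * nsq x * h'' (nsq x)) * v x) =
  2 * (\int[leb2 R]_(x in Omega) dx (fun x => x.1 * (h' (nsq x) * v x)) x +
       \int[leb2 R]_(x in Omega) dy (fun x => x.2 * (h' (nsq x) * v x)) x).
  have i1 := L2M_integrable mO Ux2 vx2; have i2 := L2M_integrable mO Uy2 vy2.
  have i3 := L2M_integrable mO lapC v2.
  have i4 := L2_integrable mO fO xx2; have i5 := L2_integrable mO fO yy2.
  rewrite -RintegralD //; last exact: (integrableD mO i1 i2).
  rewrite -RintegralD // -RintegralZl //; last exact: (integrableD mO i4 i5).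
  apply: eq_Rintegral => x; rewrite inE => Ox.
  have Kx : K x by exact: subset_closure.
  rewrite (gradU _ Kx).1 (gradU _ Kx).2 (xE _ Kx).1 (yE _ Kx).2 /=.
  rewrite (wE _ Kx).1 (wE _ Kx).2 /=.
  have [-> ->] := (radial_C1 dh').2 _ (closure_annulus_punctured Kx).
  have -> : dx (@fst R R) x = 1 by have [_ /(_ x) []] :=
    Ck1_fst (@setT (R * R)).
  have -> : dy (@snd R R) x = 1 by have [_ /(_ x) []] :=
    Ck1_snd (@setT (R * R)).
  by rewrite /nsq; ring.
rewrite dX dY in iD.
move: iD; set A := Rintegral _ _ _; set B := Rintegral _ _ _ => iD.
have move_term (a b c d : R) : a + b = c - d -> a = - b + c - d.
  by move=> abcd; rewrite -addrA -abcd; ring.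
apply: move_term.
rewrite iD; transitivity (2 * (r2 * (h' (r2 ^+ 2) * circle_int r2 v) -
  r1 * (h' (r1 ^+ 2) * circle_int r1 v))); last by ring.
by rewrite -F1 -F2 /=; ring.
Qed.

End radial_function.

End Green.

(** * Poincare's inequality *)

Section Poincare.
Context {R : realType}.
Variables (r1 r2 : R).
Hypotheses (r1_gt0 : 0 < r1) (lt_r12 : r1 < r2).
Local Notation mu := (@lebesgue_measure R).
Local Notation Omega := (annulus r1 r2).
Local Notation K := (closure (annulus r1 r2)).
Implicit Types (x : R * R).

Let r2_gt0 : 0 < r2. Proof. exact: lt_trans lt_r12. Qed.

Let mO : measurable (Omega : set (plane R)).
Proof. exact: measurable_annulus. Qed.
Let ma : measurable (@angles R : set (measurableTypeR R)).
Proof. exact: measurable_angles. Qed.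

(* The radial function with [- Delta U = 1] and [dU/dn = 0] on the outer
   circle. *)
Let h (s : R) : R := r2 ^+ 2 / 4 * ln s - s / 4.
Let h' (s : R) : R := r2 ^+ 2 / 4 * s^-1 - 1 / 4.
Let h'' (s : R) : R := - (r2 ^+ 2 / 4 * s ^- 2).

Let hC2 : C2_pos h h' h''.
Proof.
move=> s s0; split.
- rewrite (_ : h = (r2 ^+ 2 / 4) \*: @ln R - 4^-1 \*: id); last first.
    by apply/funext => t; rewrite /h [t / 4]mulrC.
  have := is_deriveB (is_deriveZ (r2 ^+ 2 / 4) (is_derive1_ln s0))
    (is_deriveZ 4^-1 (is_derive_id s (1 : R))).
  by move=> H; apply: (is_derive_eq H); rewrite /h' /GRing.scale /= mulr1 div1r.
- have sn0 : s != 0 by rewrite gt_eqF.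
  have -> : h' = (r2 ^+ 2 / 4) \*: (fun y : R => y^-1) - cst (1 / 4 : R).
    by apply/funext => t; rewrite /h'.
  have := is_deriveB (is_deriveZ (r2 ^+ 2 / 4) (@is_deriveV _ id s 1 1 sn0
    (is_derive_id s (1 : R))))
    (is_derive_cst (1 / 4 : R) s (1 : R)).
  by move=> H; apply: (is_derive_eq H); rewrite /h'' /GRing.scale /= mulr1
    subr0 mulrN.
- apply: cvgN; apply: cvgMl_tmp; apply: cvgV;
    first by rewrite expf_neq0 // gt_eqF.
  exact: exprn_continuous.
Qed.

(** Half of the squared L2 norm [P] is absorbed in the left-hand side. *)
Let absorb (A P B X Y c c' N1 N2 : R) : 0 <= N1 -> 0 <= N2 -> 0 <= X ->
  0 <= Y -> 0 <= B -> c <= c' -> 0 <= c' ->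
  A = P - c * B -> A <= 2^-1 * P + (4 * N1 * X + 4 * N2 * Y) ->
  P <= (8 * (N1 + N2) + 2 * c') * (X + Y + B).
Proof.
move=> N10 N20 X0 Y0 B0 cc c0 AE AP.
have cB := ler_wpM2r B0 cc.
have := mulr_ge0 N10 Y0; have := mulr_ge0 N20 X0; have := mulr_ge0 N10 B0.
have := mulr_ge0 N20 B0; have := mulr_ge0 c0 X0; have := mulr_ge0 c0 Y0.
by lra.
Qed.

(** Testing the solution of [- Delta U = 1] against [phi ^ 2] controls
    the L2 norm of [phi] by its gradient and its values on the inner circle. *)
Lemma poincare : exists2 C : R, 0 <= C & forall phi, C1_closure Omega phi ->
  \int[leb2 R]_(x in Omega) (phi x ^+ 2) <=
  C * (\int[leb2 R]_(x in Omega) (dx phi x ^+ 2) +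
       \int[leb2 R]_(x in Omega) (dy phi x ^+ 2) +
       \int[mu]_(t in angles) (phi (circle r1 t) ^+ 2)).
Proof.
have UC := radial_C1_closure r1_gt0 lt_r12 hC2.
set U := h \o _ in UC.
have [M1 hM1] : exists M, forall x, K x -> `|dx U x| <= M.
  by apply: continuous_bounded => // x /(C1_closureP UC) [_ _ _ c _]; exact: c.
have [M2 hM2] : exists M, forall x, K x -> `|dy U x| <= M.
  by apply: continuous_bounded => // x /(C1_closureP UC) [_ _ _ _ c]; exact: c.
pose c1 := 2 * r1 * h' (r1 ^+ 2) * r1.
(* twice the constants of the two Young inequalities below and of the term on
   the inner circle *)
exists (8 * (M1 ^+ 2 + M2 ^+ 2) + 2 * `|c1|).
  by rewrite addr_ge0 // mulr_ge0 // addr_ge0 // sqr_ge0.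
move=> phi pC.
have [ppC ppE] := C1_closureM pC pC.
have := radial_green r1_gt0 lt_r12 hC2 ppC.
have -> : h' (r2 ^+ 2) = 0 by rewrite /h'; field; rewrite gt_eqF.
rewrite mulr0 mul0r addr0.
have [p2 px2 py2] := C1_L2 r1_gt0 lt_r12 pC.
have [U2 Ux2 Uy2] := C1_L2 r1_gt0 lt_r12 UC.
have [pc _] := C1_circle_L2 r1_gt0 lt_r12 pC.
rewrite (@eq_Rintegral _ _ _ (leb2 R) _ (fun x => - (1 * phi x ^+ 2))
  (fun x => (_ + _) * _)); last first.
  move=> x; rewrite inE => Ox.
  have s0 : nsq x != 0.
    by rewrite gt_eqF //; apply: (closure_annulus_punctured r1_gt0 lt_r12);
      exact: subset_closure.
  by rewrite /h' /h''; field.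
rewrite (@eq_Rintegral _ _ _ (leb2 R) _ (fun x => -1 * phi x ^+ 2) (fun x =>
  - _)); last first.
  by move=> x _; rewrite mulN1r mul1r.
have ip := L2_sqr_integrable mO p2.
rewrite RintegralZl // mulN1r opprK.
have -> : 2 * r1 * h' (r1 ^+ 2) * circle_int r1 (fun x => phi x * phi x) =
    c1 * \int[mu]_(t in angles) (phi (circle r1 t) ^+ 2).
  by rewrite /circle_int /c1 -!mulrA.
set P := \int[leb2 R]_(x in Omega) (phi x ^+ 2).
set B := \int[mu]_(t in angles) _.
set X := \int[leb2 R]_(x in Omega) (dx phi x ^+ 2).
set Y := \int[leb2 R]_(x in Omega) (dy phi x ^+ 2).
set A := Rintegral _ _ _ => AE.
have ix := L2_sqr_integrable mO px2; have iy := L2_sqr_integrable mO py2.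
have AP : A <= 2^-1 * P + (4 * M1 ^+ 2 * X + 4 * M2 ^+ 2 * Y).
  rewrite /A /P /X /Y -(RintegralZl _ mO ip) -(RintegralZl _ mO ix)
    -(RintegralZl _ mO iy).
  rewrite -RintegralD //; last 2 first.
  - exact: (integrableZl mO (4 * M1 ^+ 2) ix).
  - exact: (integrableZl mO (4 * M2 ^+ 2) iy).
  rewrite -RintegralD //; last 2 first.
  - exact: (integrableZl mO 2^-1 ip).
  - exact: (integrableD mO (integrableZl mO (4 * M1 ^+ 2) ix)
      (integrableZl mO (4 * M2 ^+ 2) iy)).
  have [_ ppx2 ppy2] := C1_L2 r1_gt0 lt_r12 ppC.
  apply: le_Rintegral => //.
  - exact: (integrableD mO (L2M_integrable mO Ux2 ppx2) (L2M_integrable mO Uy2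
      ppy2)).
  - exact: (integrableD mO (integrableZl mO 2^-1 ip)
      (integrableD mO (integrableZl mO (4 * M1 ^+ 2) ix)
      (integrableZl mO (4 * M2 ^+ 2) iy))).
  - move=> x Ox; have Kx : K x by exact: subset_closure.
    have [-> ->] := ppE _ Kx.
    (* weighted so that each partial derivative uses a quarter of [phi ^ 2] *)
    have young (a b m : R) : `|a| <= m ->
        2 * a * (phi x * b) <= 4^-1 * phi x ^+ 2 + 4 * m ^+ 2 * b ^+ 2.
      move=> am; have : a ^+ 2 <= m ^+ 2.
        by rewrite -ler_sqrt ?sqr_ge0 // !sqrtr_sqr (le_trans am) // ler_norm.
      have := sqr_ge0 (phi x / 2 - 2 * a * b); have := sqr_ge0 b.
      move=> b0 sq am2; have : a ^+ 2 * b ^+ 2 <= m ^+ 2 * b ^+ 2 by exact: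
        ler_wpM2r.
      by nra.
    have := young _ (dx phi x) _ (hM1 _ Kx); have :=
      young _ (dy phi x) _ (hM2 _ Kx).
    by lra.
have X0 : 0 <= X by apply: Rintegral_ge0 => x _; exact: sqr_ge0.
have Y0 : 0 <= Y by apply: Rintegral_ge0 => x _; exact: sqr_ge0.
have B0 : 0 <= B by apply: Rintegral_ge0 => x _; exact: sqr_ge0.
exact: (absorb (sqr_ge0 M1) (sqr_ge0 M2) X0 Y0 B0 (ler_norm c1) (normr_ge0 c1)
  AE AP).
Qed.

(** Poincare's inequality holds for the smooth functions that approximate [w],
    and its right-hand side tends to [0] along them. *)
Lemma vanishing_H1 w Gw tw : H1 r1 r2 w Gw -> is_trace r1 r2 w Gw tw ->
  \int[leb2 R]_(x in Omega) ((Gw x).1 ^+ 2) = 0 ->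
  \int[leb2 R]_(x in Omega) ((Gw x).2 ^+ 2) = 0 ->
  \int[mu]_(t in angles) (tw (circle r1 t) ^+ 2) = 0 ->
  ae_eq (leb2 R) Omega w (cst 0).
Proof.
move=> [w2 Gx2 Gy2 _] [t12 _ [phi [phiC cvw [cvx cvy] cvt _]]] Gx0 Gy0 t0.
have [C C0 poinc] := poincare.
have phi2 n := C1_L2 r1_gt0 lt_r12 (phiC n).
have phic n := C1_circle_L2 r1_gt0 lt_r12 (phiC n).
have cw := L2_cvg_sqr mO (fun n => let: And3 a _ _ := phi2 n in a) w2 cvw.
have cx := L2_cvg_sqr mO (fun n => let: And3 _ a _ := phi2 n in a) Gx2 cvx.
have cy := L2_cvg_sqr mO (fun n => let: And3 _ _ a := phi2 n in a) Gy2 cvy.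
have ct := L2_cvg_sqr ma (fun n => (phic n).1) t12 cvt.
apply: (L2_sqr_eq0 mO w2).
set W := Rintegral _ _ _.
have W0 : 0 <= W by apply: Rintegral_ge0 => x _; exact: sqr_ge0.
apply/eqP; rewrite eq_le W0 andbT.
pose bound n := 2 * \int[leb2 R]_(x in Omega) ((phi n x - w x) ^+ 2) +
  4 * C * (\int[leb2 R]_(x in Omega) (((dx \o phi) n x - (fst \o Gw) x) ^+ 2) +
     \int[leb2 R]_(x in Omega) (((dy \o phi) n x - (snd \o Gw) x) ^+ 2) +
     \int[mu]_(t in angles)
       (((phi n \o circle r1) t - (tw \o circle r1) t) ^+ 2)).
have bound0 : bound @ \oo --> 0.
  rewrite (_ : 0 = 2 * 0 + 4 * C * (0 + 0 + 0)); last by ring.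
  apply: cvgD; first exact: cvgMl_tmp cw.
  by apply: cvgMl_tmp; apply: cvgD ct; exact: cvgD.
apply: (ler_cvg_to (cvg_cst W) bound0).
apply: nearW => n; rewrite /bound.
have [p2 px2 py2] := phi2 n; have [pc _] := phic n.
have hw : W <= 2 * \int[leb2 R]_(x in Omega) ((phi n x - w x) ^+ 2) +
    2 * \int[leb2 R]_(x in Omega) (phi n x ^+ 2).
  rewrite (@eq_Rintegral _ _ _ (leb2 R) _ (fun x => (w x - phi n x) ^+ 2)
    (fun x => (phi n x - w x) ^+ 2)); last by move=> x _; ring.
  have := integral_sqrD_le mO (L2B mO w2 p2) p2.
  by under eq_Rintegral do rewrite subrK.
have sq d (T : measurableType d) (m : {measure set T -> \bar R}) D
    (mD : measurable D) (f g : T -> R) : L2 m D f -> L2 m D g ->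
    \int[m]_(x in D) (g x ^+ 2) = 0 ->
    \int[m]_(x in D) (f x ^+ 2) <= 2 * \int[m]_(x in D) ((f x - g x) ^+ 2).
  move=> f2 g2 g0; have := integral_sqrD_le mD (L2B mD f2 g2) g2.
  rewrite g0 mulr0 addr0.
  by under eq_Rintegral do rewrite subrK.
have hx := sq _ _ _ _ mO _ _ px2 Gx2 Gx0.
have hy := sq _ _ _ _ mO _ _ py2 Gy2 Gy0.
have ht := sq _ _ _ _ ma _ _ pc t12 t0.
apply: le_trans hw _; rewrite lerD2l.
have := poinc _ (phiC n).
set P := Rintegral _ _ _ => hP.
apply: (@le_trans _ _ (2 * (C * (
     2 * \int[leb2 R]_(x in Omega) (((dx \o phi) n x - (fst \o Gw) x) ^+ 2) +
     2 * \int[leb2 R]_(x in Omega) (((dy \o phi) n x - (snd \o Gw) x) ^+ 2) +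
     2 * \int[mu]_(t in angles)
       (((phi n \o circle r1) t - (tw \o circle r1) t) ^+ 2))))).
  rewrite ler_pM2l //; apply: le_trans hP _.
  by apply: ler_wpM2l => //; apply: lerD; [exact: lerD|].
by rewrite le_eqVlt; apply/orP; left; apply/eqP; ring.
Qed.

End Poincare.

(** * Radial variational solutions *)

Section Variational.
Context {R : realType}.
Variables (r1 r2 : R).
Hypotheses (r1_gt0 : 0 < r1) (lt_r12 : r1 < r2).
Local Notation mu := (@lebesgue_measure R).
Local Notation Omega := (annulus r1 r2).
Local Notation K := (closure (annulus r1 r2)).
Implicit Types (x : R * R) (u v f tu tv : R * R -> R) (Gu Gv : R * R -> R * R).

Let mO : measurable (Omega : set (plane R)).
Proof. exact: measurable_annulus. Qed.
Let ma : measurable (@angles R : set (measurableTypeR R)).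
Proof. exact: measurable_angles. Qed.
Let fa : (mu (@angles R) < +oo)%E.
Proof. exact: angles_finite. Qed.

Let addr_le0_eq0 (a b : R) : a + b <= 0 -> 0 <= a -> 0 <= b -> a = 0 /\ b = 0.
Proof. by move=> *; split; lra. Qed.

Let robin_gap (A B I G a c h Q T : R) :
  A = I - G - a * (h - c) * T -> B + a * Q = I + a * c * T - G ->
  B - A = - (a * (Q - h * T)).
Proof.
by move=> -> hB; rewrite -[B](addrK (a * Q)) hB; ring.
Qed.

Lemma dirichlet_formE Gu Gv : L2 (leb2 R) Omega (fst \o Gu) ->
  L2 (leb2 R) Omega (snd \o Gu) -> L2 (leb2 R) Omega (fst \o Gv) ->
  L2 (leb2 R) Omega (snd \o Gv) ->
  dirichlet_form r1 r2 Gu Gv =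
  \int[leb2 R]_(x in Omega) ((Gu x).1 * (Gv x).1) +
  \int[leb2 R]_(x in Omega) ((Gu x).2 * (Gv x).2).
Proof.
move=> u1 u2 v1 v2.
by rewrite -RintegralD //; [exact: (L2M_integrable mO u1 v1)|
  exact: (L2M_integrable mO u2 v2)].
Qed.

Lemma dirichlet_form_diff Gu Gv : L2 (leb2 R) Omega (fst \o Gu) ->
  L2 (leb2 R) Omega (snd \o Gu) -> L2 (leb2 R) Omega (fst \o Gv) ->
  L2 (leb2 R) Omega (snd \o Gv) ->
  let Gw x := ((Gu x).1 - (Gv x).1, (Gu x).2 - (Gv x).2) in
  dirichlet_form r1 r2 Gu Gw - dirichlet_form r1 r2 Gv Gw =
  \int[leb2 R]_(x in Omega) (((Gu x).1 - (Gv x).1) ^+ 2) +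
  \int[leb2 R]_(x in Omega) (((Gu x).2 - (Gv x).2) ^+ 2).
Proof.
move=> u1 u2 v1 v2 Gw.
have w1 : L2 (leb2 R) Omega (fst \o Gw) := L2B mO u1 v1.
have w2 : L2 (leb2 R) Omega (snd \o Gw) := L2B mO u2 v2.
rewrite (dirichlet_formE u1 u2 w1 w2) (dirichlet_formE v1 v2 w1 w2).
rewrite opprD addrACA.
rewrite -(RintegralB mO (L2M_integrable mO u1 w1) (L2M_integrable mO v1 w1)).
rewrite -(RintegralB mO (L2M_integrable mO u2 w2) (L2M_integrable mO v2 w2)).
by congr (_ + _); apply: eq_Rintegral => x _ /=; ring.
Qed.

(** An approximating sequence for [u], shifted by the smooth function [v], is
    one for the difference. *)
Lemma H1B u Gu tu v : H1 r1 r2 u Gu -> is_trace r1 r2 u Gu tu ->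
  C1_closure Omega v ->
  let Gw x := ((Gu x).1 - dx v x, (Gu x).2 - dy v x) in
  H1 r1 r2 (fun x => u x - v x) Gw /\
  is_trace r1 r2 (fun x => u x - v x) Gw (fun x => tu x - v x).
Proof.
move=> [u2 Gu1 Gu2 wu] [tu1 tu2 [phi [phiC cu [cx cy] c1 c2]]] vC Gw.
have [v2 vx2 vy2] := C1_L2 r1_gt0 lt_r12 vC.
have [vc1 vc2] := C1_circle_L2 r1_gt0 lt_r12 vC.
have [_ _ _ wv] := C1_H1 r1_gt0 lt_r12 vC.
split; split.
- exact: (L2B mO u2 v2).
- exact: (L2B mO Gu1 vx2).
- exact: (L2B mO Gu2 vy2).
- move=> psi tpsi; have [ux uy] := wu _ tpsi; have [vx vy] := wv _ tpsi.
  have psiC : C1_closure Omega psi.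
    by exists setT; split; [exact: openT|exact: subsetT|have [+ _ _] := tpsi;
      exact].
  have [p2 px2 py2] := C1_L2 r1_gt0 lt_r12 psiC.
  have sub (a b a' b' p p' : R * R -> R) : L2 (leb2 R) Omega a ->
    L2 (leb2 R) Omega b ->
      L2 (leb2 R) Omega a' -> L2 (leb2 R) Omega b' -> L2 (leb2 R) Omega p ->
      L2 (leb2 R) Omega p' ->
      \int[leb2 R]_(x in Omega) (a x * p' x) = - (\int[leb2 R]_(x in Omega) (a'
        x * p x)) ->
      \int[leb2 R]_(x in Omega) (b x * p' x) = - (\int[leb2 R]_(x in Omega) (b'
        x * p x)) ->
      \int[leb2 R]_(x in Omega) ((a x - b x) * p' x) =
      - (\int[leb2 R]_(x in Omega) ((a' x - b' x) * p x)).
    move=> a2 b2 a'2 b'2 p_2 p'2 ea eb.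
    under eq_Rintegral do rewrite mulrBl.
    under [in RHS]eq_Rintegral do rewrite mulrBl.
    rewrite (RintegralB mO (L2M_integrable mO a2 p'2) (L2M_integrable mO b2
      p'2)).
    rewrite (RintegralB mO (L2M_integrable mO a'2 p_2) (L2M_integrable mO b'2
      p_2)).
    by rewrite ea eb; ring.
  split; first exact: (sub _ _ _ _ _ _ u2 v2 Gu1 vx2 p2 px2 ux vx).
  exact: (sub _ _ _ _ _ _ u2 v2 Gu2 vy2 p2 py2 uy vy).
- exact: (L2B ma tu1 vc1).
- exact: (L2B ma tu2 vc2).
- have phiB n := C1_closureB (phiC n) vC.
  have same d (T : measurableType d) (m : {measure set T -> \bar R}) (D : set T)
      (a a' : nat -> T -> R) (b b' : T -> R) :
      (forall n, {in D, forall z, a' n z - b' z = a n z - b z}) ->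
      L2_cvg m D a b -> L2_cvg m D a' b'.
    move=> E; rewrite /L2_cvg; suff -> : (fun n =>
      Lnorm m 2%:E (EFin \o (a' n \- b') \_ D)) =
      (fun n => Lnorm m 2%:E (EFin \o (a n \- b) \_ D)) by [].
    apply/funext => n; congr Lnorm; apply/funext => z /=.
    by rewrite !patchE; case: ifPn => // Dx; rewrite /= E.
  exists (fun n x => phi n x - v x); split.
  + by move=> n; exact: (phiB n).1.
  + by apply: same cu => n x _; ring.
  + split.
    * apply: same cx => n x; rewrite inE => Ox /=.
      by rewrite ((phiB n).2 x (subset_closure Ox)).1; ring.
    * apply: same cy => n x; rewrite inE => Ox /=.
      by rewrite ((phiB n).2 x (subset_closure Ox)).2; ring.
  + by apply: same c1 => n x _ /=; ring.
  + by apply: same c2 => n x _ /=; ring.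
Qed.

Section radial_solution.
Variables (h h' h'' : R -> R).
Hypothesis hC2 : C2_pos h h' h''.

Let U : R * R -> R := h \o @nsq R.
Let GU (x : R * R) : R * R := (dx U x, dy U x).
Let UC : C1_closure Omega U.
Proof. exact: radial_C1_closure hC2. Qed.
Let lap (x : R * R) : R := 4 * h' (nsq x) + 4 * nsq x * h'' (nsq x).

Let lap_L2 : L2 (leb2 R) Omega lap.
Proof.
apply: continuous_L2 => // x Kx.
have px := closure_annulus_punctured r1_gt0 lt_r12 Kx.
have [_ dh' ch''] := hC2 px.
have ch' := derive_continuous dh'.
apply: cvgD; first by apply: cvgMl_tmp; exact: (radial_continuous ch').
apply: cvgM; last exact: (radial_continuous ch'').
by apply: cvgMl_tmp; exact: nsq_continuous.
Qed.

(** Both sides of Green's formula are continuous along the smooth functions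
    that define the trace. *)
Lemma radial_green_trace v Gv tv : H1 r1 r2 v Gv -> is_trace r1 r2 v Gv tv ->
  dirichlet_form r1 r2 GU Gv =
  - (\int[leb2 R]_(x in Omega) (lap x * v x)) +
  2 * r2 * h' (r2 ^+ 2) * circle_int r2 tv -
  2 * r1 * h' (r1 ^+ 2) * circle_int r1 tv.
Proof.
move=> [v2 Gv1 Gv2 _] [t1 t2 [phi [phiC cv [cx cy] c1 c2]]].
have [U2 Ux2 Uy2] := C1_L2 r1_gt0 lt_r12 UC.
have phi2 n := C1_L2 r1_gt0 lt_r12 (phiC n).
have phic n := C1_circle_L2 r1_gt0 lt_r12 (phiC n).
have p0 n : L2 (leb2 R) Omega (phi n) by have [p _ _] := phi2 n; exact: p.
have px n : L2 (leb2 R) Omega ((dx \o phi) n) by have [_ p _] := phi2 n;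
  exact: p.
have py n : L2 (leb2 R) Omega ((dy \o phi) n) by have [_ _ p] := phi2 n;
  exact: p.
have lx := L2_cvg_integral mO px Gv1 Ux2 cx.
have ly := L2_cvg_integral mO py Gv2 Uy2 cy.
have lv := L2_cvg_integral mO p0 v2 lap_L2 cv.
have one := L2_cst ma 1 fa.
have l1 := L2_cvg_integral ma (fun n => (phic n).1) t1 one c1.
have l2 := L2_cvg_integral ma (fun n => (phic n).2) t2 one c2.
rewrite (@dirichlet_formE GU Gv Ux2 Uy2 Gv1 Gv2).
have limit (A B C E : nat -> R) a b c' e c1' c2' :
    A @ \oo --> a -> B @ \oo --> b -> C @ \oo --> c' -> E @ \oo --> e ->
    (forall n, A n = - B n + c2' * E n - c1' * C n) ->
    a = - b + c2' * e - c1' * c'.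
  move=> cA cB cC cE ABCE; apply: (cvg_unique _ cA);
    first exact: norm_hausdorff.
  rewrite (_ : A = fun n => - B n + c2' * E n - c1' * C n); last exact/funext.
  apply: cvgB; last exact: cvgMl_tmp.
  by apply: cvgD; [exact: cvgN|exact: cvgMl_tmp].
have circ (rho c : R) t : c * circle_int rho t =
    c * rho * \int[mu]_(a in angles) (cst 1 a * (t \o circle rho) a).
  by rewrite /circle_int mulrA; under [in RHS]eq_Rintegral do rewrite mul1r.
rewrite !circ; apply: (limit _ _ _ _ _ _ _ _ _ _ _ lv l1 l2) => [|n].
  exact: cvgD lx ly.
have := radial_green r1_gt0 lt_r12 hC2 (phiC n).
by rewrite !circ (RintegralD mO (L2M_integrable mO Ux2 (px n))
  (L2M_integrable mO Uy2 (py n))).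
Qed.

Let lap_int f v : L2 (leb2 R) Omega f -> L2 (leb2 R) Omega v ->
  ae_eq (leb2 R) Omega f (fun x => - lap x) ->
  \int[leb2 R]_(x in Omega) (f x * v x) = - (\int[leb2 R]_(x in Omega) (lap x *
    v x)).
Proof.
move=> f2 v2 flap.
rewrite -mulN1r -RintegralZl //; last exact: (L2M_integrable mO lap_L2 v2).
apply: (ae_eq_Rintegral mO).
- by apply: measurable_funM; [exact: L2_measurable f2|exact: L2_measurable v2].
- apply: measurable_funM => //; apply: measurable_funM;
    [exact: L2_measurable lap_L2|exact: L2_measurable v2].
- by apply: filterS flap => x /= E Ox; rewrite (E Ox); ring.
Qed.

Let circle_r1 t : U (circle r1 t) = h (r1 ^+ 2).
Proof. by rewrite /U /= nsq_circle. Qed.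

Variables (f : R * R -> R) (c g : R).
Hypothesis f2 : L2 (leb2 R) Omega f.
(* Almost everywhere only: the source of the adjoint equation contains a state
   that is determined up to a null set. *)
Hypothesis flap : ae_eq (leb2 R) Omega f (fun x => - lap x).
Hypothesis flux2 : - (2 * r2 * h' (r2 ^+ 2)) = g.

Lemma radial_weak v Gv tv : H1 r1 r2 v Gv -> is_trace r1 r2 v Gv tv ->
  dirichlet_form r1 r2 GU Gv =
  (\int[leb2 R]_(x in Omega) (f x * v x)) - g * circle_int r2 tv -
  2 * r1 * h' (r1 ^+ 2) * circle_int r1 tv.
Proof.
move=> Hv tr; have [v2 _ _ _] := Hv.
rewrite (radial_green_trace Hv tr) (lap_int f2 v2 flap) -flux2 mulNr opprK.
by [].
Qed.

Lemma circle_int_trace0 tv : L2 mu angles (tv \o circle r1) ->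
  trace_eq r1 tv 0 -> circle_int r1 tv = 0.
Proof.
move=> t2 t0; rewrite /circle_int.
rewrite (ae_eq_Rintegral ma (g := cst 0) (L2_measurable ma t2) _ t0) //.
by rewrite /Rintegral integral0 mulr0.
Qed.

Lemma radial_dirichlet_solution : h (r1 ^+ 2) = c ->
  dirichlet_solution r1 r2 f c g U.
Proof.
move=> hc; exists GU, U; split.
- exact: C1_H1.
- exact: C1_trace.
- by apply: aeW => t _ /=; rewrite circle_r1.
- move=> v Gv tv Hv tr tv0; have [t1 _ _] := tr.
  by rewrite (radial_weak Hv tr) (circle_int_trace0 t1 tv0) mulr0 subr0.
Qed.

Lemma circle_intM_U tv : L2 mu angles (tv \o circle r1) ->
  circle_int r1 (fun x => U x * tv x) = h (r1 ^+ 2) * circle_int r1 tv.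
Proof.
move=> t2; rewrite /circle_int mulrCA -(RintegralZl _ ma (L2_integrable ma fa
  t2)).
by congr (_ * _); apply: eq_Rintegral => t _; rewrite circle_r1.
Qed.

Lemma radial_robin_solution a : 2 * r1 * h' (r1 ^+ 2) = a * (h (r1 ^+ 2) - c) ->
  robin_solution r1 r2 a f c g U.
Proof.
move=> hc; exists GU, U; split.
- exact: C1_H1.
- exact: C1_trace.
- move=> v Gv tv Hv tr; have [t1 _ _] := tr.
  by rewrite (radial_weak Hv tr) hc circle_intM_U //; ring.
Qed.

(** The first bound says that the energy of [u - U] vanishes, the second one
    that its trace vanishes on the inner circle. *)
Let vanishing u Gu tu : H1 r1 r2 u Gu -> is_trace r1 r2 u Gu tu ->
  dirichlet_form r1 r2 Gu (fun x => ((Gu x).1 - (GU x).1,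
    (Gu x).2 - (GU x).2)) -
  dirichlet_form r1 r2 GU (fun x => ((Gu x).1 - (GU x).1,
    (Gu x).2 - (GU x).2)) <= 0 ->
  \int[mu]_(t in angles) ((tu (circle r1 t) - U (circle r1 t)) ^+ 2) <= 0 ->
  ae_eq (leb2 R) Omega u U.
Proof.
move=> Hu tr; have [Hw trw] := H1B Hu tr UC.
have [_ Gu1 Gu2 _] := Hu.
have [_ Ux2 Uy2] := C1_L2 r1_gt0 lt_r12 UC.
rewrite (@dirichlet_form_diff Gu GU Gu1 Gu2 Ux2 Uy2) => form0 tr0.
have [||XE YE] := addr_le0_eq0 form0.
- by apply: Rintegral_ge0 => x _; exact: sqr_ge0.
- by apply: Rintegral_ge0 => x _; exact: sqr_ge0.
have T0 : 0 <= \int[mu]_(t in angles) ((tu (circle r1 t) - U (circle r1 t)) ^+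
  2).
  by apply: Rintegral_ge0 => x _; exact: sqr_ge0.
have w0 : ae_eq (leb2 R) Omega (fun x => u x - U x) (cst 0).
  apply: (vanishing_H1 r1_gt0 lt_r12 Hw trw).
  - exact: XE.
  - exact: YE.
  - by apply/eqP; rewrite eq_le tr0 T0.
by apply: filterS w0 => x /= E /E /eqP; rewrite subr_eq0 => /eqP.
Qed.

(** The difference of two solutions is itself an admissible test function. *)
Lemma dirichlet_solution_unique u : h (r1 ^+ 2) = c ->
  dirichlet_solution r1 r2 f c g u -> ae_eq (leb2 R) Omega u U.
Proof.
move=> hc [Gu [tu [Hu tr tc weak]]].
have [Hw trw] := H1B Hu tr UC.
have [t1 _ _] := trw.
have tw0 : trace_eq r1 (fun x => tu x - U x) 0.
  by apply: filterS tc => t /= E /E ->; rewrite circle_r1 hc subrr.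
apply: (vanishing Hu tr).
- rewrite (weak _ _ _ Hw trw tw0) (radial_weak Hw trw).
  by rewrite (circle_int_trace0 t1 tw0) mulr0 subr0 subrr.
- rewrite (ae_eq_Rintegral ma (g := cst 0) _ _ _) //.
  + by rewrite /Rintegral integral0.
  + by apply: measurable_funX; exact: (L2_measurable ma t1).
  + by apply: filterS tw0 => t /= E /E ->; rewrite expr0n.
Qed.

(** Tested against the difference [w] of two solutions, the two equations give
    that the energy of [w] plus [a] times the integral of [w ^ 2] over the inner
    circle is [0]; both terms are nonnegative as [a > 0]. *)
Lemma robin_solution_unique a u : 0 < a ->
  2 * r1 * h' (r1 ^+ 2) = a * (h (r1 ^+ 2) - c) ->
  robin_solution r1 r2 a f c g u -> ae_eq (leb2 R) Omega u U.
Proof.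
move=> a0 hc [Gu [tu [Hu tr weak]]].
have [Hw trw] := H1B Hu tr UC.
have [t1 _ _] := trw; have [tu1 _ _] := tr.
have := weak _ _ _ Hw trw; have := radial_weak Hw trw; rewrite hc.
set A := dirichlet_form _ _ GU _; set B := dirichlet_form _ _ Gu _.
set T := \int[mu]_(t in angles) ((tu (circle r1 t) - U (circle r1 t)) ^+ 2).
have TE : circle_int r1 (fun x => tu x * (tu x - U x)) -
    h (r1 ^+ 2) * circle_int r1 (fun x => tu x - U x) = r1 * T.
  rewrite -circle_intM_U // /circle_int -mulrBr; congr (_ * _).
  have [U1 _] := C1_circle_L2 r1_gt0 lt_r12 UC.
  rewrite -RintegralB //; last 2 first.
  - exact: (L2M_integrable ma tu1 t1).
  - exact: (L2M_integrable ma U1 t1).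
  by apply: eq_Rintegral => t _; ring.
move=> hA hB; have BA : B - A = - (a * r1 * T).
  by rewrite -mulrA -TE; exact: robin_gap hA hB.
have T0 : 0 <= T by apply: Rintegral_ge0 => x _; exact: sqr_ge0.
have form_ge0 : 0 <= B - A.
  have [_ Gu1 Gu2 _] := Hu.
  have [_ Ux2 Uy2] := C1_L2 r1_gt0 lt_r12 UC.
  rewrite /A /B (@dirichlet_form_diff Gu GU Gu1 Gu2 Ux2 Uy2).
  by apply: addr_ge0; apply: Rintegral_ge0 => x _; exact: sqr_ge0.
have ar0 : 0 < a * r1 by exact: mulr_gt0.
apply: (vanishing Hu tr).
- by rewrite -/A -/B BA oppr_le0 mulr_ge0 // ltW.
- by rewrite -/T -(pmulr_rle0 _ ar0) -oppr_ge0 -BA.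
Qed.

End radial_solution.

End Variational.

(** * Closed forms of the states and of the adjoint states *)

Section Closed_forms.
Context {R : realType}.
Implicit Types (s : R) (h : R -> R).

Let dD (f g : R -> R) s (a b : R) : is_derive s 1 f a -> is_derive s 1 g b ->
  is_derive s 1 (fun t => f t + g t) (a + b).
Proof. exact: is_deriveD. Qed.

Let dM (f g : R -> R) s (a b : R) : is_derive s 1 f a -> is_derive s 1 g b ->
  is_derive s 1 (fun t => f t * g t) (f s * b + g s * a).
Proof. exact: is_deriveM. Qed.

Let dZ (k : R) (f : R -> R) s (a : R) : is_derive s 1 f a ->
  is_derive s 1 (fun t => k * f t) (k * a).
Proof. exact: is_deriveZ. Qed.

(** In the variable [s = r^2], the four closed forms are combinations of [1],
    [s], [s^2], [log s] and [s log s] on the positive reals. *)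
Lemma polylog_C2 h (k0 k1 k2 k3 k4 : R) :
  (forall s, 0 < s -> h s = k0 + k1 * s + k2 * s ^+ 2 + k3 * ln s
    + k4 * (s * ln s)) ->
  C2_pos h (fun s => k1 + 2 * k2 * s + k3 * s^-1 + k4 * (ln s + 1))
           (fun s => 2 * k2 - k3 * s ^- 2 + k4 * s^-1).
Proof.
move=> hE s s0; have sn0 : s != 0 by rewrite gt_eqF.
have dln : is_derive s 1 (fun t : R => ln t) s^-1 := is_derive1_ln s0.
have did : is_derive s 1 (fun t : R => t) 1 := is_derive_id s (1 : R).
have dV : is_derive s 1 (fun t : R => t^-1) (- s ^- 2).
  by have := is_deriveV sn0 did; rewrite /GRing.scale /= mulr1.
have dc (k : R) : is_derive s 1 (fun _ : R => k) 0 := is_derive_cst k s (1 : R).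
have near_pos : \forall t \near s, 0 < t by exact: lt_nbhsr.
split.
- apply: (@near_eq_is_derive _ _ _
    (fun t : R => k0 + k1 * t + k2 * (t * t) + k3 * ln t + k4 * (t * ln t))).
    by apply: filterS near_pos => t t0; rewrite (hE t t0) expr2.
  apply: (is_derive_eq (dD (dD (dD (dD (dc k0) (dZ k1 did)) (dZ k2 (dM did
    did)))
    (dZ k3 dln)) (dZ k4 (dM did dln)))).
  by rewrite mulfV //; ring.
- apply: (is_derive_eq (dD (dD (dD (dc k1) (dZ (2 * k2) did)) (dZ k3 dV))
    (dZ k4 (dD dln (dc 1))))).
  by rewrite mulr1 add0r addr0 mulrN.
- have cV : {for s, continuous (fun t : R => t^-1)} by exact: cvgV.
  apply: cvgD; last by apply: cvgMl_tmp; exact: cV.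
  apply: cvgB; first exact: cvg_cst.
  apply: cvgMl_tmp; apply: cvgV; first by rewrite expf_neq0.
  exact: exprn_continuous.
Qed.

Lemma ln_sqrt_div (r1 s : R) : 0 < r1 -> 0 < s ->
  ln (Num.sqrt s / r1) = ln s / 2 - ln r1.
Proof.
move=> r10 s0; have q0 : 0 < Num.sqrt s by rewrite sqrtr_gt0.
rewrite ln_div ?posrE //; congr (_ - _).
by rewrite -[in RHS](sqr_sqrtr (ltW s0)) lnXn //; field.
Qed.

Variables (r1 r2 : R).
Hypotheses (r1_gt0 : 0 < r1) (lt_r12 : r1 < r2).

Let r2_gt0 : 0 < r2. Proof. exact: lt_trans lt_r12. Qed.

(** Radial solutions of [- Delta u = - 4 B]: a multiple of [r^2] plus a radial
    harmonic function. The derivatives are kept in the shape of [polylog_C2],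
    with [k2 = k4 = 0]. *)
Section state.
Variables (e : R -> R) (A B C : R).
Hypothesis eE : forall r : R, 0 < r -> e r = A * ln (r / r1) + B * r ^+ 2 + C.

Definition state_h' (s : R) := B + 2 * 0 * s + A / 2 * s^-1 + 0 * (ln s + 1).
Definition state_h'' (s : R) := 2 * 0 - A / 2 * s ^- 2 + 0 * s^-1.

Lemma state_C2 : C2_pos (e \o Num.sqrt) state_h' state_h''.
Proof.
apply: (polylog_C2 (k0 := C - A * ln r1)) => s s0 /=.
rewrite eE ?sqrtr_gt0 // ln_sqrt_div // sqr_sqrtr ?ltW //.
by field.
Qed.

Lemma state_lap s : 0 < s -> 4 * state_h' s + 4 * s * state_h'' s = 4 * B.
Proof.
move=> s0; have sn0 : s != 0 by rewrite gt_eqF.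
by rewrite /state_h' /state_h''; field.
Qed.

Lemma state_inner : e (Num.sqrt (r1 ^+ 2)) = B * r1 ^+ 2 + C.
Proof.
rewrite sqrtr_sqr gtr0_norm // eE // divff ?gt_eqF // ln1; ring.
Qed.

Lemma state_slope (r : R) : 0 < r -> 2 * r * state_h' (r ^+ 2) = A / r
  + 2 * B * r.
Proof.
move=> r0; have rn0 : r != 0 by rewrite gt_eqF.
by rewrite /state_h'; field.
Qed.

End state.

(** The adjoint equation [- Delta p = u - zd] for a radial state
    [u = A log (r / r1) + B r^2 + C]: a particular solution is obtained from
    [Delta (r^2 (log (r / r1) - 1)) = 4 log (r / r1)] and
    [Delta r^4 = 16 r^2]. *)
Section adjoint.
Variables (e : R -> R) (A B C E1 E2 : R).
Hypothesis eE : forall r : R, 0 < r ->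
  e r = - (B / 16 * r ^+ 4) - A / 4 * r ^+ 2 * (ln (r / r1) - 1) - C / 4 * r ^+
    2
        + E1 * ln (r / r1) + E2.

Definition adjoint_h' (s : R) := (A / 4 * (ln r1 + 1) - C / 4) +
  2 * (- (B / 16)) * s + E1 / 2 * s^-1 + (- (A / 8)) * (ln s + 1).
Definition adjoint_h'' (s : R) := 2 * (- (B / 16)) - E1 / 2 * s ^- 2
  + (- (A / 8)) * s^-1.

Lemma adjoint_C2 : C2_pos (e \o Num.sqrt) adjoint_h' adjoint_h''.
Proof.
apply: (polylog_C2 (k0 := E2 - E1 * ln r1)) => s s0 /=.
rewrite eE ?sqrtr_gt0 // ln_sqrt_div //.
rewrite (_ : Num.sqrt s ^+ 4 = (Num.sqrt s ^+ 2) ^+ 2); last by rewrite -exprM.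
by rewrite sqr_sqrtr ?ltW //; field.
Qed.

Lemma adjoint_lap s : 0 < s -> - (4 * adjoint_h' s + 4 * s * adjoint_h'' s) =
  A * ln (Num.sqrt s / r1) + B * s + C.
Proof.
move=> s0; have sn0 : s != 0 by rewrite gt_eqF.
by rewrite ln_sqrt_div // /adjoint_h' /adjoint_h''; field.
Qed.

Lemma adjoint_inner : e (Num.sqrt (r1 ^+ 2)) =
  - (B / 16 * r1 ^+ 4) + A / 4 * r1 ^+ 2 - C / 4 * r1 ^+ 2 + E2.
Proof.
rewrite sqrtr_sqr gtr0_norm // eE // divff ?gt_eqF // ln1; ring.
Qed.

Lemma adjoint_slope (r : R) : 0 < r -> 2 * r * adjoint_h' (r ^+ 2) =
  - (B / 4 * r ^+ 3) - A / 2 * r * (ln (r / r1) - 1) - A / 4 * r - C / 2 * r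
      + E1 / r.
Proof.
move=> r0; have rn0 : r != 0 by rewrite gt_eqF.
rewrite ln_div ?posrE // /adjoint_h' lnXn //.
by rewrite -mulr_natr; field.
Qed.

End adjoint.

End Closed_forms.

(** * States coupled with their adjoint states *)

Section Optimality_system.
Context {R : realType}.
Variables (r1 r2 : R).
Hypotheses (r1_gt0 : 0 < r1) (lt_r12 : r1 < r2).
Local Notation Omega := (annulus r1 r2).
Implicit Types (x : R * R) (u p f : R * R -> R).

Let r2_gt0 : 0 < r2. Proof. exact: lt_trans lt_r12. Qed.

Let mO : measurable (Omega : set (plane R)).
Proof. exact: measurable_annulus. Qed.
Let fO : (leb2 R (Omega : set (plane R)) < +oo)%E.
Proof. exact: annulus_finite. Qed.

Variables (eu ep : R -> R) (A B C E1 E2 g q zd : R).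
Hypotheses
  (euE : forall r : R, 0 < r -> eu r = A * ln (r / r1) + B * r ^+ 2 + C)
  (epE : forall r : R, 0 < r ->
    ep r = - (B / 16 * r ^+ 4) - A / 4 * r ^+ 2 * (ln (r / r1) - 1)
           - (C - zd) / 4 * r ^+ 2 + E1 * ln (r / r1) + E2)
  (Bg : - (4 * B) = g)
  (u_outer : - (A / r2 + 2 * B * r2) = q)
  (p_outer : - (B / 4 * r2 ^+ 3) - A / 2 * r2 * (ln (r2 / r1) - 1) - A / 4 * r2
             - (C - zd) / 2 * r2 + E1 / r2 = 0).

Local Notation U := (eu \o polar_r).
Local Notation P := (ep \o polar_r).

Let uC2 := state_C2 r1_gt0 euE.
Let pC2 := adjoint_C2 r1_gt0 epE.

Let nsq_gt0 x : Omega x -> 0 < nsq x.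
Proof.
by move=> Ox; apply: (closure_annulus_punctured r1_gt0 lt_r12);
  exact: subset_closure.
Qed.

Let g_L2 : L2 (leb2 R) Omega (cst g : R * R -> R).
Proof. exact: L2_cst. Qed.

Let u_lap : ae_eq (leb2 R) Omega (cst g)
  (fun x => - (4 * state_h' A B (nsq x) + 4 * nsq x * state_h'' A (nsq x))).
Proof.
by apply: aeW => x /nsq_gt0 s0; rewrite state_lap.
Qed.

Let u_flux : - (2 * r2 * state_h' A B (r2 ^+ 2)) = q.
Proof. by rewrite state_slope. Qed.

Let p_flux : - (2 * r2 * adjoint_h' r1 A B (C - zd) E1 (r2 ^+ 2)) = 0.
Proof. by rewrite (adjoint_slope r1_gt0) // p_outer oppr0. Qed.

Let source_L2 u : L2 (leb2 R) Omega u -> L2 (leb2 R) Omega (fun x => u x - zd).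
Proof. by move=> u2; apply: (L2B mO u2); exact: L2_cst. Qed.

Let U_L2 : L2 (leb2 R) Omega U.
Proof. by have [] := C1_L2 r1_gt0 lt_r12 (radial_C1_closure r1_gt0 lt_r12 uC2).
  Qed.

Let p_lap u : ae_eq (leb2 R) Omega u U ->
  ae_eq (leb2 R) Omega (fun x => u x - zd)
  (fun x => - (4 * adjoint_h' r1 A B (C - zd) E1 (nsq x) +
               4 * nsq x * adjoint_h'' A B E1 (nsq x))).
Proof.
apply: filterS => x /= E Ox; rewrite (E Ox) adjoint_lap ?nsq_gt0 //.
by rewrite euE ?sqrtr_gt0 ?nsq_gt0 // polar_r_sqr; ring.
Qed.

(** Uniqueness of the state makes the source of the adjoint equation equal to
    [U - zd] almost everywhere, which is what uniqueness of the adjoint state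
    asks for. *)
Lemma dirichlet_system b : B * r1 ^+ 2 + C = b ->
  - (B / 16 * r1 ^+ 4) + A / 4 * r1 ^+ 2 - (C - zd) / 4 * r1 ^+ 2 + E2 = 0 ->
  [/\ dirichlet_solution r1 r2 (cst g) b q U,
      dirichlet_solution r1 r2 (fun x => U x - zd) 0 0 P &
      forall u p, dirichlet_solution r1 r2 (cst g) b q u ->
        dirichlet_solution r1 r2 (fun x => u x - zd) 0 0 p ->
        ae_eq (leb2 R) Omega u U /\ ae_eq (leb2 R) Omega p P].
Proof.
rewrite -(state_inner r1_gt0 euE) -(adjoint_inner r1_gt0 epE) => ub pb.
have UU : ae_eq (leb2 R) Omega U U by exact: aeW.
split.
- exact: (radial_dirichlet_solution r1_gt0 lt_r12 uC2 g_L2 u_lap u_flux ub).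
- exact: (radial_dirichlet_solution r1_gt0 lt_r12 pC2 (source_L2 U_L2) (p_lap
    UU) p_flux pb).
- move=> u p su sp.
  have uU := dirichlet_solution_unique r1_gt0 lt_r12 uC2 g_L2 u_lap u_flux ub
    su.
  have [Gu [tu [[u2 _ _ _] _ _ _]]] := su.
  split; first exact: uU.
  exact: (dirichlet_solution_unique r1_gt0 lt_r12 pC2 (source_L2 u2) (p_lap uU)
    p_flux pb sp).
Qed.

Lemma robin_system a b : 0 < a ->
  A / r1 + 2 * B * r1 = a * (B * r1 ^+ 2 + C - b) ->
  - (B / 4 * r1 ^+ 3) + A / 2 * r1 - A / 4 * r1 - (C - zd) / 2 * r1 + E1 / r1 =
  a * (- (B / 16 * r1 ^+ 4) + A / 4 * r1 ^+ 2 - (C - zd) / 4 * r1 ^+ 2 + E2) ->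
  [/\ robin_solution r1 r2 a (cst g) b q U,
      robin_solution r1 r2 a (fun x => U x - zd) 0 0 P &
      forall u p, robin_solution r1 r2 a (cst g) b q u ->
        robin_solution r1 r2 a (fun x => u x - zd) 0 0 p ->
        ae_eq (leb2 R) Omega u U /\ ae_eq (leb2 R) Omega p P].
Proof.
move=> a0 u_inner p_inner.
have ub : 2 * r1 * state_h' A B (r1 ^+ 2) = a * ((eu \o Num.sqrt) (r1 ^+ 2) -
  b).
  by rewrite state_slope // /= (state_inner r1_gt0 euE).
have pb : 2 * r1 * adjoint_h' r1 A B (C - zd) E1 (r1 ^+ 2) =
    a * ((ep \o Num.sqrt) (r1 ^+ 2) - 0).
  rewrite (adjoint_slope r1_gt0) // /= (adjoint_inner r1_gt0 epE) subr0
    -p_inner.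
  by rewrite divff ?gt_eqF // ln1; ring.
have UU : ae_eq (leb2 R) Omega U U by exact: aeW.
split.
- exact: (radial_robin_solution r1_gt0 lt_r12 uC2 g_L2 u_lap u_flux ub).
- exact: (radial_robin_solution r1_gt0 lt_r12 pC2 (source_L2 U_L2) (p_lap UU)
    p_flux pb).
- move=> u p su sp.
  have uU := robin_solution_unique r1_gt0 lt_r12 uC2 g_L2 u_lap u_flux a0 ub su.
  have [Gu [tu [[u2 _ _ _] _ _]]] := su.
  split; first exact: uU.
  exact: (robin_solution_unique r1_gt0 lt_r12 pC2 (source_L2 u2) (p_lap uU)
    p_flux a0 pb sp).
Qed.

End Optimality_system.

(** * The explicit solutions *)

Theorem lemma3p1 (R : realType) (r1 r2 g q b zd alpha : R)
    (r1_gt0 : 0 < r1) (lt_r12 : r1 < r2) (alpha_gt0 : 0 < alpha) :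
  let is_u := dirichlet_solution r1 r2 (cst g) b q in
  let is_p u := dirichlet_solution r1 r2 (fun x => u x - zd) 0 0 in
  let is_ua := robin_solution r1 r2 alpha (cst g) b q in
  let is_pa ua := robin_solution r1 r2 alpha (fun x => ua x - zd) 0 0 in
  let U := u_expr r1 r2 g q b \o polar_r in
  let P := p_expr r1 r2 g q b zd \o polar_r in
  let Ua := ua_expr r1 r2 g q b alpha \o polar_r in
  let Pa := pa_expr r1 r2 g q b zd alpha \o polar_r in
  (* i) *)
  ([/\ is_u U, is_p U P &
      forall u p, is_u u -> is_p u p ->
        ae_eq (leb2 R) (annulus r1 r2) u U /\
        ae_eq (leb2 R) (annulus r1 r2) p P]) /\
  (* ii) *)
  ([/\ is_ua Ua, is_pa Ua Pa &
      forall ua pa, is_ua ua -> is_pa ua pa ->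
        ae_eq (leb2 R) (annulus r1 r2) ua Ua /\
        ae_eq (leb2 R) (annulus r1 r2) pa Pa]).
Proof.
have r2_gt0 : 0 < r2 by exact: lt_trans lt_r12.
have r1n0 : r1 != 0 by rewrite gt_eqF.
have r2n0 : r2 != 0 by rewrite gt_eqF.
have an0 : alpha != 0 by rewrite gt_eqF.
have lnE : ln (r2 / r1) = ln r2 - ln r1 by rewrite ln_div.
(* The states are [A log (r / r1) + B r^2 + C]; in passing from the Dirichlet to
   the Robin condition only the constant term changes, from [C] to [Ca]. *)
pose A := g * r2 ^+ 2 / 2 - q * r2.
pose B := - (g / 4).
pose C := g * r1 ^+ 2 / 4 + b.
pose Ca := C + (A - g * r1 ^+ 2 / 2) / (alpha * r1).
split.
- apply: (dirichlet_system r1_gt0 lt_r12 (A := A) (B := B) (C := C)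
    (E1 := D1 r1 r2 g q b zd) (E2 := D2 r1 r2 g q b zd)).
  + by move=> r r0; rewrite /u_expr /A /B /C; field; rewrite ?r1n0 ?r2n0 ?an0.
  + by move=> r r0; rewrite /p_expr /A /B /C; field; rewrite ?r1n0 ?r2n0 ?an0.
  + by rewrite /B; field.
  + by rewrite /A /B; field; rewrite ?r1n0 ?r2n0 ?an0.
  + by rewrite /D1 lnE /A /B /C; field; rewrite ?r1n0 ?r2n0 ?an0.
  + by rewrite /B /C; field; rewrite ?r1n0 ?r2n0 ?an0.
  + by rewrite /D2 /A /B /C; field; rewrite ?r1n0 ?r2n0 ?an0.
- apply: (robin_system r1_gt0 lt_r12 (A := A) (B := B) (C := Ca)
    (E1 := D1a r1 r2 g q b zd alpha) (E2 := D2a r1 r2 g q b zd alpha)) => //.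
  + by move=> r r0; rewrite /ua_expr /Ca /A /B /C; field;
      rewrite ?r1n0 ?r2n0 ?an0.
  + by move=> r r0; rewrite /pa_expr /Ca /A /B /C; field;
      rewrite ?r1n0 ?r2n0 ?an0.
  + by rewrite /B; field.
  + by rewrite /A /B; field; rewrite ?r1n0 ?r2n0 ?an0.
  + by rewrite /D1a lnE /Ca /A /B /C; field; rewrite ?r1n0 ?r2n0 ?an0.
  + by rewrite /Ca /A /B /C; field; rewrite ?r1n0 ?r2n0 ?an0.
  + by rewrite /D2a /Ca /A /B /C; field; rewrite ?r1n0 ?r2n0 ?an0.
Qed.
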